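(* For each $1\le n\le\omega$, the equivalence relation $=^{+n}$ is in the spectrum of the meager ideal; that is, there is an equivalence relation $F$ on a Polish space $Y$ such that $F$ and $=^{+n}$ are Borel bireducible and for every non-meager (Borel) set $C\subseteq Y$, $F\restriction C$ is Borel bireducible with $F$.
   Context: Friedman–Stanley jumps: for an equivalence relation $E$ on $X$, $E^+$ on $X^{\mathbb N}$ is $x\mathrel{E^+}y\iff\{[x(i)]_E:i\in\mathbb N\}=\{[y(i)]_E:i\in\mathbb N\}$. $=^{+0}$ is equality on $\mathbb R$, $=^{+(n+1)}=(=^{+n})^+$, and $=^{+\omega}=\prod_{n<\omega}=^{+n}$ (product equivalence relation on the product of the domains: coordinatewise equivalence). $E\le_B F$ means there is a Borel reduction; Borel bireducible means $\le_B$ in both directions. *)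

(* Defs.v *)
From HB Require Import structures.
From mathcomp Require Import all_boot all_order all_algebra.
From mathcomp Require Import all_classical all_reals all_analysis.
From mathcomp Require Import Rstruct Rstruct_topology.
Set Implicit Arguments. Unset Strict Implicit. Unset Printing Implicit Defensive.
Import Order.TTheory GRing.Theory Num.Theory.
Local Open Scope classical_set_scope.
Local Open Scope ring_scope.
Local Notation R := Rdefinitions.R.

Definition separable (T : topologicalType) : Prop :=
  exists D : set T, countable D /\ closure D = setT.

Definition is_metric (T : Type) (d : T -> T -> R) : Prop :=
  (forall x y, 0 <= d x y) /\ (forall x y, d x y = 0 <-> x = y) /\
  (forall x y, d x y = d y x) /\ (forall x y z, d x z <= d x y + d y z).

Definition metric_compatible (T : topologicalType) (d : T -> T -> R) : Prop :=
  forall A : set T, open A <->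
    (forall x, A x -> exists e : R, 0 < e /\ [set y | d x y < e] `<=` A).

Definition metric_complete (T : Type) (d : T -> T -> R) : Prop :=
  forall u : nat -> T,
    (forall e : R, 0 < e -> exists N : nat, forall m n : nat, (N <= m)%N -> (N <= n)%N ->
        d (u m) (u n) < e) ->
    exists l : T, forall e : R, 0 < e -> exists N : nat, forall n : nat, (N <= n)%N ->
        d (u n) l < e.

Definition polish (T : topologicalType) : Prop :=
  separable T /\
  exists d : T -> T -> R, is_metric d /\ metric_compatible d /\ metric_complete d.

Definition borel (T : topologicalType) (A : set T) : Prop :=
  <<s (@open T) >> A.

Definition borel_fun (X Y : topologicalType) (f : X -> Y) : Prop :=
  forall B : set Y, borel B -> borel (f @^-1` B).

Definition nowhere_dense (T : topologicalType) (A : set T) : Prop :=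
  interior (closure A) = set0.

Definition meager (T : topologicalType) (A : set T) : Prop :=
  exists F : nat -> set T, (forall n, nowhere_dense (F n)) /\
    A `<=` \bigcup_n F n.

Definition equivalence_rel (X : Type) (E : X -> X -> Prop) : Prop :=
  (forall x, E x x) /\ (forall x y, E x y -> E y x) /\
  (forall x y z, E x y -> E y z -> E x z).

Definition borel_reducible (X Y : topologicalType)
    (E : X -> X -> Prop) (F : Y -> Y -> Prop) : Prop :=
  exists f : X -> Y, borel_fun f /\ forall x y, E x y <-> F (f x) (f y).

Definition borel_bireducible (X Y : topologicalType)
    (E : X -> X -> Prop) (F : Y -> Y -> Prop) : Prop :=
  borel_reducible E F /\ borel_reducible F E.

(** Borel reducibility for the restriction F|C of F to a Borel set C
    (C carries the relative Borel structure; since C is Borel, Borel maps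
    on C are exactly restrictions of Borel maps on the whole space,
    and Borel maps into C are exactly Borel maps with range in C). *)
Definition borel_reducible_restr_to (X Y : topologicalType)
    (F : X -> X -> Prop) (C : set X) (E : Y -> Y -> Prop) : Prop :=
  exists f : X -> Y, borel_fun f /\
    forall x y, C x -> C y -> (F x y <-> E (f x) (f y)).

Definition borel_reducible_to_restr (X Y : topologicalType)
    (E : Y -> Y -> Prop) (F : X -> X -> Prop) (C : set X) : Prop :=
  exists f : Y -> X, borel_fun f /\ (forall y, C (f y)) /\
    forall x y, E x y <-> F (f x) (f y).

Definition borel_bireducible_restr (X : topologicalType)
    (F : X -> X -> Prop) (C : set X) : Prop :=
  borel_reducible_restr_to F C F /\ borel_reducible_to_restr F F C.

Definition fs_jump (X : Type) (E : X -> X -> Prop) (x y : nat -> X) : Prop :=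
  range (fun i => [set z | E (x i) z]) = range (fun i => [set z | E (y i) z]).

Fixpoint plus_space (n : nat) : topologicalType :=
  match n with
  | 0 => (R : topologicalType)
  | m.+1 => (prod_topology (fun _ : nat => plus_space m) : topologicalType)
  end.

Fixpoint eq_plus (n : nat) : plus_space n -> plus_space n -> Prop :=
  match n return plus_space n -> plus_space n -> Prop with
  | 0 => fun x y => x = y
  | m.+1 => fun x y => @fs_jump (plus_space m) (@eq_plus m) x y
  end.

Definition plus_omega_space : topologicalType :=
  prod_topology (fun n : nat => plus_space n).

Definition eq_plus_omega (x y : plus_omega_space) : Prop :=
  forall n : nat, @eq_plus n (x n) (y n).

Definition in_meager_spectrum (X : topologicalType) (E : X -> X -> Prop) : Prop :=
  exists (Y : topologicalType) (F : Y -> Y -> Prop),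
    polish Y /\ equivalence_rel F /\ borel_bireducible F E /\
    forall C : set Y, borel C -> ~ meager C -> borel_bireducible_restr F C.

(* Main.v *)
Require Import Defs.
From HB Require Import structures.
From mathcomp Require Import all_boot all_order all_algebra.
From mathcomp Require Import all_classical all_reals all_analysis.
From mathcomp Require Import Rstruct Rstruct_topology zify lra.

(** The relation [F] lives on the Cantor space: a point codes a sequence of reals [u_j],
    the sets of level 0, and, for each [k], a bipartite graph telling which sets of level [k]
    belong to which sets of level [k + 1]; two points are related when they have the same
    hereditarily countable sets at level [n - 1] (at all levels, for [n = omega]).  For a
    generic point these graphs are random, so an arbitrary hereditarily countable set has to
    be completed, invariantly, into a random tower.

    To this end an element of level [k] of the new tower is a name [(a_1 .. a_l, j)], where the
    [a_s] range over the sets of level [k] occurring in the given tower [T] (closed under sets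
    [{a, delta}], which separate points) and [j] is an integer coding a finite table.  Whether
    [(a, j)] belongs to [(b, i)] is read off the table with the larger number, at the membership
    matrix of [a] against [b].  Extensionality and separation let distinct names be told apart
    by such matrices, hence all finite patterns are realised and the completed tower is random;
    conversely [T] is recovered from it.  The real attached to a name of level 0 is its image
    by a Mycielski map, so that finitely many distinct names yield mutually generic reals.
    The names are then enumerated generically, one finite state at a time, always taking the
    least admissible next state: the resulting point lies in the given non-meager set and is a
    Borel function of the input. *)

Set Implicit Arguments. Unset Strict Implicit. Unset Printing Implicit Defensive.
Import Order.TTheory GRing.Theory Num.Theory.

(** * Perfect sets of mutually generic reals *)

(* Locked: unfolding [pickle] during conversion does not terminate in practice. *)
HB.lock Definition enc (T : countType) (t : T) : nat := pickle t.
HB.lock Definition dec (T : countType) (n : nat) : option T := pickle_inv n.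
Arguments dec {T} n.

Lemma encK (T : countType) (t : T) : dec (enc t) = Some t.
Proof. by rewrite enc.unlock dec.unlock pickleK_inv. Qed.

Lemma enc_inj (T : countType) : injective (@enc T).
Proof. by move=> t u /(congr1 (@dec T)); rewrite !encK => -[]. Qed.

Lemma decK (T : countType) (n : nat) (t : T) : dec n = Some t -> enc t = n.
Proof. by rewrite enc.unlock dec.unlock => e; have := @pickle_invK T n; rewrite e. Qed.

Definition extends (f : nat -> bool) (s : seq bool) : Prop :=
  forall i, i < size s -> nth false s i = f i.

Fixpoint all_seqs (T : Type) (s : seq T) (m : nat) : seq (seq T) :=
  if m is m'.+1 then [seq x :: t | x <- s, t <- all_seqs s m'] else [:: [::]].

Lemma mem_all_seqs (T : eqType) (s t : seq T) :
  {subset t <= s} -> t \in all_seqs s (size t).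
Proof.
elim: t => [|x t IH] sub //=.
apply/allpairsP; exists (x, t); split=> //=; first by apply: sub; rewrite inE eqxx.
by apply: IH => y yt; apply: sub; rewrite inE yt orbT.
Qed.

Lemma prefix_nth (T : eqType) (x0 : T) (s t : seq T) i :
  prefix s t -> i < size s -> nth x0 t i = nth x0 s i.
Proof. by move=> /prefixP[u ->] lt; rewrite nth_cat lt. Qed.

Lemma extends_prefix (f : nat -> bool) (s t : seq bool) :
  prefix s t -> extends f t -> extends f s.
Proof.
move=> st ft i lt; rewrite -(ft i); last exact: leq_trans lt (size_prefix st).
by rewrite (prefix_nth _ st).
Qed.

Lemma exists_bound (n : nat) (P : nat -> nat -> Prop) :
  (forall i, i < n -> exists b, forall m, b <= m -> P i m) ->
  exists b, forall m, b <= m -> forall i, i < n -> P i m.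
Proof.
elim: n => [|n IH] H; first by exists 0.
have [b Hb] := IH (fun i lt => H i (ltnW lt)).
have [c Hc] := H n (ltnSn n).
exists (maxn b c) => m; rewrite geq_max => /andP[bm cm] i.
by rewrite ltnS leq_eqVlt => /orP[/eqP->|]; [exact: Hc|exact: Hb].
Qed.

(** A node [(c, s)] stands for all points [(c, z)] with [z] beginning with [s]; the fusion attaches
    to it an initial segment common to their images. *)
Definition node : Type := (nat * seq bool)%type.

Section Mycielski.
Variables (pre : nat -> seq bool) (G : nat -> seq (seq bool) -> Prop).
Hypothesis G_dense : forall l t, exists t', [/\ size t' = size t,
  (forall i, prefix (nth [::] t i) (nth [::] t' i)) & G l t'].

(** [G] need not persist under extension, so the tuple satisfying it is kept as a witness [t] below
    the current strings; this weaker condition does persist. *)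
Definition meets (s : node -> seq bool) (tk : nat * seq node) : Prop :=
  exists t, [/\ size t = size tk.2,
    (forall i, i < size t -> prefix (nth [::] t i) (s (nth (0, [::]) tk.2 i))) & G tk.1 t].

Lemma meets_mono s s' tk :
  (forall v, prefix (s v) (s' v)) -> meets s tk -> meets s' tk.
Proof.
move=> ss' [t [st Ht Gt]]; exists t; split=> // i lt.
exact: prefix_trans (Ht i lt) (ss' _).
Qed.

Lemma meets_tasks (tasks : seq (nat * seq node)) (s : node -> seq bool) :
  exists s' : node -> seq bool, (forall v, prefix (s v) (s' v)) /\
    forall tk, tk \in tasks -> uniq tk.2 -> meets s' tk.
Proof.
elim: tasks s => [|[l ns] tasks IH] s.
  by exists s; split=> // v; exact: prefix_refl.
have [s1 [ss1 H1]] := IH s.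
have [un|nun] := boolP (uniq ns); last first.
  exists s1; split=> // tk; rewrite inE => /orP[/eqP->|/H1//] /= un.
  by rewrite un in nun.
have [t [st Ht Gt]] := G_dense l (map s1 ns).
rewrite size_map in st.
(* Only the strings at the nodes of [ns] change; as [ns] has no repetition, the entries of [t] are
   assigned without conflict. *)
pose s2 v := if v \in ns then nth [::] t (index v ns) else s1 v.
have s12 v : prefix (s1 v) (s2 v).
  rewrite /s2; case: ifP => vns; last exact: prefix_refl.
  have := Ht (index v ns); rewrite (nth_map (0, [::])) ?index_mem //.
  by rewrite nth_index.
exists s2; split=> [v|tk]; first exact: prefix_trans (ss1 v) (s12 v).
rewrite inE => /orP[/eqP-> _|tkt un2]; last exact: meets_mono s12 (H1 _ tkt un2).
exists t; split=> //= i; rewrite st => lt.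
by rewrite /s2 mem_nth // index_uniq // prefix_refl.
Qed.

Definition level_nodes (n : nat) : seq node :=
  [seq (c, s) | c <- iota 0 n, s <- all_seqs [:: true; false] n].

Definition level_tasks (n : nat) : seq (nat * seq node) :=
  [seq (l, ns) | l <- iota 0 n, ns <- flatten
     [seq all_seqs (level_nodes n) m | m <- iota 0 n]].

Lemma stage_step (n : nat) (s : node -> seq bool) :
  exists s' : node -> seq bool, [/\ forall v, prefix (s v) (s' v),
    forall v, n <= size (s' v) &
    forall tk, tk \in level_tasks n -> uniq tk.2 -> meets s' tk].
Proof.
have [s1 [ss1 H1]] := meets_tasks (level_tasks n) s.
(* The padding makes the lengths tend to infinity, so that the limit is a total sequence. *)
exists (fun v => s1 v ++ nseq n false); split=> [v|v|tk tkn un].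
- exact: prefix_trans (ss1 v) (prefix_prefix _ _).
- by rewrite size_cat size_nseq leq_addl.
by apply: meets_mono (H1 _ tkn un) => v; exact: prefix_prefix.
Qed.

(** A fusion argument: stage [n] treats the finitely many tuples of fewer than [n] distinct nodes of
    level [n] against the [G l] with [l < n]. Finitely many distinct points pass through distinct
    nodes at every large level, so their images meet each [G l]. *)
Lemma mycielski : exists phi : nat * (nat -> bool) -> nat -> bool,
  [/\ forall c z, extends (phi (c, z)) (pre c),
      exists g : nat -> nat -> seq bool -> bool,
        forall c z q, phi (c, z) q = g c q (mkseq z q.+1) &
      forall l (ws : seq (nat * (nat -> bool))) w0,
        (forall i j, i < size ws -> j < size ws -> nth w0 ws i = nth w0 ws j -> i = j) ->
        exists t, [/\ size t = size ws,
          (forall i, i < size t -> extends (phi (nth w0 ws i)) (nth [::] t i)) & G l t]].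
Proof.
have [step stepP] : exists step : nat -> (node -> seq bool) -> node -> seq bool,
    forall n s, [/\ forall v, prefix (s v) (step n s v),
    forall v, n <= size (step n s v) &
    forall tk, tk \in level_tasks n -> uniq tk.2 -> meets (step n s) tk].
  have [f Hf] := choice (fun p : nat * (node -> seq bool) => stage_step p.1 p.2).
  by exists (fun n s => f (n, s)) => n s; exact: (Hf (n, s)).
pose sg := fix sg n : node -> seq bool := if n is m.+1
  then step n (fun v => sg m (v.1, take m v.2)) else fun v => pre v.1.
have sgS n c z : prefix (sg n (c, mkseq z n)) (sg n.+1 (c, mkseq z n.+1)).
  have [H _ _] := stepP n.+1 (fun v => sg n (v.1, take n v.2)).
  have := H (c, mkseq z n.+1) => /=.
  by rewrite (_ : take n _ = mkseq z n) // /mkseq -map_take take_iota (minn_idPl (leqnSn n)).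
have sg_mono m n c z : m <= n -> prefix (sg m (c, mkseq z m)) (sg n (c, mkseq z n)).
  move=> /subnK <-; elim: (n - m) => [|k IH]; first exact: prefix_refl.
  exact: prefix_trans IH (sgS _ _ _).
have sg_size n c z : n <= size (sg n (c, mkseq z n)).
  by case: n => // n; have [_ H _] := stepP n.+1 (fun v => sg n (v.1, take n v.2)); exact: H.
(* Stage [q.+1] has more than [q] bits, so no default is read, and only [q.+1] bits of the argument
   matter. *)
pose phi (w : nat * (nat -> bool)) q := nth false (sg q.+1 (w.1, mkseq w.2 q.+1)) q.
have phi_sg n c z : extends (phi (c, z)) (sg n (c, mkseq z n)).
  move=> i lt; rewrite /phi /=.
  have [le|/ltnW le] := leqP n i.+1.
    by rewrite (prefix_nth _ (sg_mono _ _ c z le)).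
  by rewrite (prefix_nth _ (sg_mono _ _ c z le)).
exists phi; split=> [c z||l ws w0 inj].
- exact: (phi_sg 0).
- by exists (fun c q s => nth false (sg q.+1 (c, s)) q).
have [b Hb] : exists b, forall m, b <= m -> forall i, i < size ws ->
    forall j, j < size ws -> i <> j ->
    ((nth w0 ws i).1, mkseq (nth w0 ws i).2 m) <> ((nth w0 ws j).1, mkseq (nth w0 ws j).2 m).
  apply: exists_bound => i lti.
  have [|b Hb] := @exists_bound (size ws) (fun j m => i <> j ->
    ((nth w0 ws i).1, mkseq (nth w0 ws i).2 m) <>
    ((nth w0 ws j).1, mkseq (nth w0 ws j).2 m)); last by exists b.
  move=> j ltj; have [->|ne] := eqVneq i j; first by exists 0.
  have neij : nth w0 ws i <> nth w0 ws j by move=> /(inj _ _ lti ltj) /eqP; rewrite (negbTE ne).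
  case: (nth w0 ws i) (nth w0 ws j) neij => [ci zi] [cj zj] /= neij.
  have [eqc|nec] := eqVneq ci cj; last by exists 0 => m _ _ [/eqP]; rewrite (negbTE nec).
  have /existsNP[k zk] : ~ (forall k, zi k = zj k).
    by move=> /funext eqz; apply: neij; rewrite eqc eqz.
  exists k.+1 => m km _ [_ /(congr1 (nth false ^~ k))].
  by rewrite !nth_mkseq.
have [d Hd] : exists d, forall m, d <= m -> forall i, i < size ws -> (nth w0 ws i).1 < m.
  by apply: exists_bound => i _; exists (nth w0 ws i).1.+1.
(* From [b] on the nodes are distinct; exceeding [d], [l] and [size ws] puts [(l, ns)] among the
   tasks of stage [n]. *)
pose n := (maxn (maxn b d) (maxn l (size ws))).+1.
pose ns := [seq (w.1, mkseq w.2 n) | w <- ws].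
have bn : b <= n by rewrite /n ltnW // ltnS !leq_max leqnn.
have dn : d <= n by rewrite /n ltnW // ltnS !leq_max leqnn orbT.
have ln : l < n by rewrite /n ltnS !leq_max leqnn !orbT.
have sn : size ws < n by rewrite /n ltnS !leq_max leqnn !orbT.
have un : uniq ns.
  apply/(uniqP (0, [::])) => i j; rewrite !inE size_map => lti ltj.
  rewrite !(nth_map w0) // => e; apply/eqP; apply: contraT => /eqP ne.
  by have := Hb n bn i lti j ltj ne e.
have [_ _ /(_ (l, ns))] := stepP n (fun v => sg n.-1 (v.1, take n.-1 v.2)).
case=> //=.
- apply/allpairsP; exists (l, ns); split=> //; first by rewrite mem_iota add0n.
  apply/flattenP; exists (all_seqs (level_nodes n) (size ns)).
    by apply: map_f; rewrite mem_iota add0n size_map.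
  apply: mem_all_seqs => _ /mapP[w wws ->].
  apply/allpairsP; exists (w.1, mkseq w.2 n); split=> //.
    by rewrite mem_iota add0n -(nth_index w0 wws) Hd // index_mem.
  rewrite -{2}(size_mkseq w.2 n); apply: mem_all_seqs => -[] _; by rewrite !inE.
move=> t [st Ht Gt]; rewrite size_map in st; exists t; split=> // i lt.
have := Ht i lt; rewrite (nth_map w0); last by rewrite -st.
move=> /extends_prefix; apply.
by have := phi_sg n (nth w0 ws i).1 (nth w0 ws i).2; rewrite -surjective_pairing.
Qed.

End Mycielski.

(** * Names and random towers *)

Definition child (Z : Type) (v : seq nat -> Z) (i : nat) : seq nat -> Z :=
  fun q => v (i :: q).

(** Equality of hereditarily countable sets of rank [k] over [Z], in back-and-forth form; only the
    leaves along paths of length [k] count. *)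
Fixpoint tree_eq (Z : Type) (k : nat) (v w : seq nat -> Z) : Prop :=
  if k is k'.+1 then
    (forall i, exists j, tree_eq k' (child v i) (child w j)) /\
    (forall j, exists i, tree_eq k' (child v i) (child w j))
  else v [::] = w [::].

Lemma tree_eq_ext (Z : Type) k (v w : seq nat -> Z) :
  (forall q, size q = k -> v q = w q) -> tree_eq k v w.
Proof.
elim: k v w => [|k IH] v w H /=; first exact: H.
by split=> i; exists i; apply: IH => q sq; apply: H; rewrite /= sq.
Qed.

Lemma tree_eq_refl (Z : Type) k (v : seq nat -> Z) : tree_eq k v v.
Proof. exact: tree_eq_ext. Qed.

Lemma tree_eq_sym (Z : Type) k (v w : seq nat -> Z) : tree_eq k v w -> tree_eq k w v.
Proof.
elim: k v w => [|k IH] v w //= [H1 H2]; split=> i.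
  by have [j /IH] := H2 i; exists j.
by have [j /IH] := H1 i; exists j.
Qed.

Lemma tree_eq_trans (Z : Type) k (u v w : seq nat -> Z) :
  tree_eq k u v -> tree_eq k v w -> tree_eq k u w.
Proof.
elim: k u v w => [|k IH] u v w /= => [-> //|[H1 H2] [H3 H4]]; split=> i.
  by have [j Hj] := H1 i; have [l Hl] := H3 j; exists l; exact: IH Hj Hl.
by have [j Hj] := H4 i; have [l Hl] := H2 j; exists l; exact: IH Hl Hj.
Qed.

Lemma tree_eq_map (Z Z' : Type) (f : Z -> Z') k (v w : seq nat -> Z) :
  injective f -> tree_eq k (f \o v) (f \o w) <-> tree_eq k v w.
Proof.
move=> injf; elim: k v w => [|k IH] v w /=; first by split=> [/injf|->].
by split=> -[H1 H2]; split=> i; [have [j /IH] := H1 i|have [j /IH] := H2 i|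
  have [j /IH] := H1 i|have [j /IH] := H2 i]; exists j.
Qed.

Lemma tree_eq_forall (Z : Type) (P : Z -> Prop) k (v w : seq nat -> Z) :
  tree_eq k v w -> (forall q, size q = k -> P (v q)) ->
  forall q, size q = k -> P (w q).
Proof.
elim: k v w => [|k IH] v w /=.
  by move=> e H q /size0nil ->; rewrite -e; exact: H.
move=> [_ H2] H [//|j q] [sq]; have [i Hi] := H2 j.
by apply: (IH _ _ Hi _ q sq) => q' sq'; apply: H; rewrite /= sq'.
Qed.

Lemma tree_eq_descend (Z : Type) (p : seq nat) k (v w : seq nat -> Z) :
  tree_eq (size p + k) v w -> exists p', size p' = size p /\
    tree_eq k (fun q => v (p ++ q)) (fun q => w (p' ++ q)).
Proof.
elim: p v w => [|i p IH] v w /=; first by exists [::].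
move=> [H1 _]; have [j /IH[p' [sp' Hp']]] := H1 i.
by exists (j :: p'); rewrite /= sp'.
Qed.

(** A tag together with a real; the tag [0] belongs to the marker, and in an input tower the tag
    will record the coordinate a leaf comes from. *)
Definition label : Type := (nat * (nat -> bool))%type.
Definition tower : Type := seq nat -> label.

(* [(r, b)] denotes the [r]-fold separator set over the base element [b]; [Some p] is
   the element sitting at the path [p] of the input, [None] the marker [delta]. *)
Definition idx : Type := (nat * option (seq nat))%type.
Definition name : Type := (seq idx * nat)%type.

Definition delta : tower := fun _ => (0, fun _ => false).

(** Codes the unordered pair of [v] and [delta], one rank higher. *)
Definition separator (v : tower) : tower :=
  fun q => if q is i :: q' then if i is 0 then v q' else delta q' else delta q.

(** Each separator raises the rank by one, so the base is read at level [k - r]; [delta] serves as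
    the base when [r] exceeds [k]. *)
Fixpoint elt (X : tower) (k r : nat) (b : option (seq nat)) {struct r} : tower :=
  match r, k with
  | 0, _ => if b is Some p then fun q => X (p ++ q) else delta
  | r'.+1, k'.+1 => separator (elt X k' r' b)
  | _.+1, 0 => delta
  end.

Definition el (X : tower) (k : nat) (a : idx) : tower := elt X k a.1 a.2.

Definition el_mem (X : tower) (k : nat) (a b : idx) : Prop :=
  exists i, tree_eq k (el X k a) (child (el X k.+1 b) i).

(** A member of a path element sits one step further along the path, and members of a separator are
    its base and [delta]. The closed family is thus transitive, and membership inside it decides
    equality. *)
Lemma el_transitive X k b i : exists a, tree_eq k (el X k a) (child (el X k.+1 b) i).
Proof.
case: b => -[|r] b.
  case: b => [p|].
    by exists (0, Some (rcons p i)); apply: tree_eq_ext => q _; rewrite /el /child /= cat_rcons.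
  by exists (0, None); exact: tree_eq_ext.
case: i => [|i]; first by exists (r, b); exact: tree_eq_ext.
by exists (0, None); exact: tree_eq_ext.
Qed.

Lemma mem_tree_eq X X' k a b a' b' :
  tree_eq k (el X k a) (el X' k a') -> tree_eq k.+1 (el X k.+1 b) (el X' k.+1 b') ->
  el_mem X k a b <-> el_mem X' k a' b'.
Proof.
move=> ea [H1 H2]; split=> -[i Hi].
  have [j Hj] := H1 i; exists j.
  exact: tree_eq_trans (tree_eq_sym ea) (tree_eq_trans Hi Hj).
have [j Hj] := H2 i; exists j.
exact: tree_eq_trans ea (tree_eq_trans Hi (tree_eq_sym Hj)).
Qed.

Lemma extensionality X k b b' : ~ tree_eq k.+1 (el X k.+1 b) (el X k.+1 b') ->
  exists a, ~ (el_mem X k a b <-> el_mem X k a b').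
Proof.
move=> ne; apply: contrapT => /forallNP H; apply: ne => /=; split=> i.
  have [a Ha] := el_transitive X k b i.
  have /contrapT[/(_ (ex_intro _ i Ha)) [j Hj] _] := H a.
  by exists j; exact: tree_eq_trans (tree_eq_sym Ha) Hj.
have [a Ha] := el_transitive X k b' i.
have /contrapT[_ /(_ (ex_intro _ i Ha)) [j Hj]] := H a.
by exists j; exact: tree_eq_trans (tree_eq_sym Hj) Ha.
Qed.

Lemma mem_separator X k r b a : el_mem X k a (r.+1, b) <->
  tree_eq k (el X k a) (el X k (r, b)) \/ tree_eq k (el X k a) delta.
Proof.
split=> [[[|i] Hi]|[H|H]]; [by left|by right|by exists 0|by exists 1].
Qed.

(** The separator over [a] contains [a] but not [a'], unless [a'] is [delta]; then the singleton of
    [delta], indexed by [(1, None)], contains [a'] but not [a]. *)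
Lemma separation X k a a' : ~ tree_eq k (el X k a) (el X k a') ->
  exists b, ~ (el_mem X k a b <-> el_mem X k a' b).
Proof.
move=> ne; have [ed|nd] := pselect (tree_eq k (el X k a') delta).
  exists (1, None) => H; have /H/mem_separator : el_mem X k a' (1, None).
    by apply/mem_separator; right.
  have : el_mem X k a (1, None).
    by apply/H/mem_separator; right.
  by move=> /mem_separator[] e _; apply: ne; exact: tree_eq_trans e (tree_eq_sym ed).
case: a ne => r b ne; exists (r.+1, b) => H.
have : el_mem X k a' (r.+1, b).
  by apply/H/mem_separator; left; exact: tree_eq_refl.
by move=> /mem_separator[/tree_eq_sym|].
Qed.

(** * Membership matrices and the extension property of names *)

Definition matrix_of (X : tower) (k : nat) (s t : seq idx) : seq (seq bool) :=
  [seq [seq `[< el_mem X k a b >] | b <- t] | a <- s].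

(** A query about a name of smaller number: its side ([false] when it is the lower one), the
    membership matrix, and its number. *)
Definition key : Type := (bool * seq (seq bool) * nat)%type.
(** The accepted keys, an initial segment for the real of a name of level [0], and a dummy number
    providing arbitrarily large codes. *)
Definition table : Type := (seq key * seq bool * nat)%type.

Definition decode (j : nat) : table :=
  if dec j is Some t then t else ([::], [::], 0).

Definition keys (j : nat) : seq key := (decode j).1.1.
Definition name_prefix (j : nat) : seq bool := (decode j).1.2.

(* Whichever of the two numbers is larger decides, so that a name whose number is large
   can prescribe its relation to all earlier names. *)
Definition decide (M : seq (seq bool)) (j i : nat) : bool :=
  if j < i then (false, M, j) \in keys i else (true, M, i) \in keys j.

Definition related (X : tower) (k : nat) (m n : name) : bool :=
  decide (matrix_of X k m.1 n.1) m.2 n.2.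

Definition name_eq (X X' : tower) (k : nat) (m n : name) : Prop :=
  [/\ m.2 = n.2, size m.1 = size n.1 &
      forall s, s < size m.1 -> tree_eq k (el X k (nth (0, None) m.1 s))
                                         (el X' k (nth (0, None) n.1 s))].

Lemma pickle_unbounded (T : countType) (t : T) (b : nat) :
  exists c : nat, b < enc (t, c).
Proof.
apply: contrapT => /forallNP H.
pose f (c : 'I_b.+2) : 'I_b.+1 := inord (enc (t, val c)).
have lec (c : nat) : enc (t, c) < b.+1 by rewrite ltnS leqNgt; apply/negP; exact: H.
have /leq_card : injective f.
  move=> c d /(congr1 val); rewrite /f /= !inordK //.
  by move=> /enc_inj [] /val_inj.
by rewrite !card_ord ltnn.
Qed.

Lemma decode_pickle (t : table) : decode (enc t) = t.
Proof. by rewrite /decode encK. Qed.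

Lemma decode_large (ks : seq key) (P : seq bool) (b : nat) :
  exists j, [/\ b < j, keys j = ks & name_prefix j = P].
Proof.
have [c Hc] := pickle_unbounded (ks, P) b.
by exists (enc (ks, P, c)); rewrite /keys /name_prefix (decode_pickle (ks, P, c)).
Qed.

Lemma name_eq_refl X k m : name_eq X X k m m.
Proof. by split=> // s _; exact: tree_eq_refl. Qed.

Lemma name_eq_sym X X' k m n : name_eq X X' k m n -> name_eq X' X k n m.
Proof. by move=> [e1 e2 H]; split=> // s; rewrite -e2 => /H /tree_eq_sym. Qed.

Lemma name_eq_trans X1 X2 X3 k m n p :
  name_eq X1 X2 k m n -> name_eq X2 X3 k n p -> name_eq X1 X3 k m p.
Proof.
move=> [e1 e2 H] [e3 e4 H']; split=> [||s lt]; [by rewrite e1|by rewrite e2|].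
by apply: tree_eq_trans (H s lt) (H' s _); rewrite -e2.
Qed.

Lemma matrix_of_eq X X' k s s' t t' :
  size s = size s' -> size t = size t' ->
  (forall i, i < size s -> tree_eq k (el X k (nth (0, None) s i)) (el X' k (nth (0, None) s' i))) ->
  (forall i, i < size t -> tree_eq k.+1 (el X k.+1 (nth (0, None) t i))
                                       (el X' k.+1 (nth (0, None) t' i))) ->
  matrix_of X k s t = matrix_of X' k s' t'.
Proof.
move=> es et Hs Ht; apply: (@eq_from_nth _ [::]); rewrite !size_map // => i lti.
rewrite !(nth_map (0, None)) -?es //.
apply: (@eq_from_nth _ false); rewrite !size_map // => j ltj.
rewrite !(nth_map (0, None)) -?et //; apply: asbool_equiv_eq.
by apply: mem_tree_eq; [exact: Hs|exact: Ht].
Qed.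

Lemma related_eq X X' k m n m' n' :
  name_eq X X' k m m' -> name_eq X X' k.+1 n n' -> related X k m n = related X' k m' n'.
Proof.
move=> [e1 e2 H] [e3 e4 H']; rewrite /related e1 e3; congr decide.
exact: matrix_of_eq.
Qed.

Lemma matrix_row_neq X k s t t' a :
  a \in s -> (exists2 i, i < size t & size t = size t' /\
    ~ (el_mem X k a (nth (0, None) t i) <-> el_mem X k a (nth (0, None) t' i))) \/
    size t <> size t' ->
  matrix_of X k s t <> matrix_of X k s t'.
Proof.
move=> as_ H /(congr1 (nth [::] ^~ (index a s))).
rewrite !(nth_map (0, None)) ?index_mem // nth_index //.
case: H => [[i lti [es ne]]|ne].
  move=> /(congr1 (nth false ^~ i)); rewrite !(nth_map (0, None)) -?es //.
  by move=> e; apply: ne; split=> /asboolP; [rewrite e|rewrite -e] => /asboolP.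
by move=> /(congr1 size); rewrite !size_map.
Qed.

Lemma matrix_col_neq X k s s' t b :
  b \in t -> (exists2 i, i < size s & size s = size s' /\
    ~ (el_mem X k (nth (0, None) s i) b <-> el_mem X k (nth (0, None) s' i) b)) \/
    size s <> size s' ->
  matrix_of X k s t <> matrix_of X k s' t.
Proof.
move=> bt [[i lti [es ne]]|ne] e; last first.
  by apply: ne; move: (congr1 size e); rewrite !size_map.
move: (congr1 (fun M => nth false (nth [::] M i) (index b t)) e).
rewrite !(nth_map (0, None)) -?es ?index_mem // nth_index // => e'.
by apply: ne; split=> /asboolP; [rewrite e'|rewrite -e'] => /asboolP.
Qed.

Lemma name_neq_cases X X' k m n : ~ name_eq X X' k m n ->
  m.2 <> n.2 \/ size m.1 <> size n.1 \/ (size m.1 = size n.1 /\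
  exists2 s, s < size m.1 & ~ tree_eq k (el X k (nth (0, None) m.1 s))
                                       (el X' k (nth (0, None) n.1 s))).
Proof.
move=> ne; have [e1|] := pselect (m.2 = n.2); last by left.
right; have [e2|] := pselect (size m.1 = size n.1); last by left.
right; split=> //; apply: contrapT => H; apply: ne; split=> // s lt.
by apply: contrapT => H'; apply: H; exists s.
Qed.

(** By extensionality some [c] belongs to exactly one of two corresponding entries, and a row for
    [c] shows it. Names of different number or length are told apart by any [c]. *)
Lemma upper_separator X k m n : ~ name_eq X X k.+1 m n ->
  exists c, forall s, c \in s -> (matrix_of X k s m.1, m.2) <> (matrix_of X k s n.1, n.2).
Proof.
move=> /name_neq_cases[ne|[ne|[es [i lti /extensionality[a Ha]]]]].
- by exists (0, None) => s _ [].
- by exists (0, None) => s cs [] + _; apply: matrix_row_neq cs _; right.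
by exists a => s cs [] + _; apply: matrix_row_neq cs _; left; exists i.
Qed.

(** Dual to the previous case: by separation, a column for [c] distinguishes two corresponding
    entries. *)
Lemma lower_separator X k m n : ~ name_eq X X k m n ->
  exists c, forall s, c \in s -> (matrix_of X k m.1 s, m.2) <> (matrix_of X k n.1 s, n.2).
Proof.
move=> /name_neq_cases[ne|[ne|[es [i lti /separation[a Ha]]]]].
- by exists (0, None) => s _ [].
- by exists (0, None) => s cs [] + _; apply: matrix_col_neq cs _; right.
by exists a => s cs [] + _; apply: matrix_col_neq cs _; left; exists i.
Qed.

Definition distinct_names (X : tower) (k : nat) (l : seq name) : Prop :=
  forall i j, i < size l -> j < size l -> i <> j ->
  ~ name_eq X X k (nth ([::], 0) l i) (nth ([::], 0) l j).

Lemma common_separator (n : nat) (P : nat -> nat -> idx -> Prop) :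
  (forall i j, i < n -> j < n -> i <> j -> exists c, P i j c) ->
  exists s : seq idx, forall i j, i < n -> j < n -> i <> j -> exists2 c, c \in s & P i j c.
Proof.
move=> H.
have [f Hf] : exists f : nat * nat -> idx, forall p,
    p.1 < n -> p.2 < n -> p.1 <> p.2 -> P p.1 p.2 (f p).
  suff /choice[f Hf] : forall p : nat * nat, exists c : idx,
      p.1 < n -> p.2 < n -> p.1 <> p.2 -> P p.1 p.2 c by exists f.
  move=> [i j] /=; have [[lti ltj ne]|N] := pselect [/\ i < n, j < n & i <> j].
    by have [c Hc] := H i j lti ltj ne; exists c.
  by exists (0, None) => lti ltj ne; exfalso; apply: N.
exists [seq f (i, j) | i <- iota 0 n, j <- iota 0 n] => i j lti ltj ne.
exists (f (i, j)); last exact: (Hf (i, j)).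
by apply/allpairsP; exists (i, j); rewrite !mem_iota /= !add0n.
Qed.

Lemma mem_selected (T : eqType) (n : nat) (f : nat -> T) (P : nat -> bool) i :
  {in gtn n &, injective f} -> i < n ->
  (f i \in [seq f j | j <- iota 0 n & P j]) = P i.
Proof.
move=> inj lt; apply/mapP/idP => [[j]|Pi]; last first.
  by exists i => //; rewrite mem_filter Pi mem_iota.
rewrite mem_filter mem_iota /= add0n => /andP[Pj ltj] /inj.
by rewrite !inE => -> //.
Qed.

(** The extension property of the random tower. Listing enough separating elements gives the older
    names pairwise different keys, and a number larger than theirs lets the table of the new name
    accept any prescribed set of these keys. *)
Lemma fresh_name X k (low up : seq name) (tl tu : nat -> bool) (P : seq bool) (b : nat) :
  (0 < k -> distinct_names X k.-1 low) -> distinct_names X k.+1 up ->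
  exists nu : name, [/\ b < nu.2, name_prefix nu.2 = P,
    (forall i, 0 < k -> i < size low -> related X k.-1 (nth ([::], 0) low i) nu = tl i) &
    (forall i, i < size up -> related X k nu (nth ([::], 0) up i) = tu i)].
Proof.
move=> dl du.
have [cu Hcu] := @common_separator (size up) _
  (fun i j li lj ne => upper_separator (du i j li lj ne)).
have [cl Hcl] : exists s : seq idx, 0 < k -> forall i j, i < size low -> j < size low ->
    i <> j -> exists2 c, c \in s & forall s0, c \in s0 ->
     (matrix_of X k.-1 (nth ([::], 0) low i).1 s0, (nth ([::], 0) low i).2) <>
     (matrix_of X k.-1 (nth ([::], 0) low j).1 s0, (nth ([::], 0) low j).2).
  have [k0|/negP nk] := boolP (0 < k); last by exists [::].
  have [cl Hcl] := @common_separator (size low) _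
    (fun i j li lj ne => lower_separator (dl k0 i j li lj ne)).
  by exists cl.
pose c := cu ++ cl.
(* These are the keys that [decide] looks up in the table of the new name; the flag keeps the two
   families apart. *)
pose fl i : key := (false, matrix_of X k.-1 (nth ([::], 0) low i).1 c, (nth ([::], 0) low i).2).
pose fu i : key := (true, matrix_of X k c (nth ([::], 0) up i).1, (nth ([::], 0) up i).2).
have injfl : 0 < k -> {in gtn (size low) &, injective fl}.
  move=> k0 i j; rewrite !inE => lti ltj [e1 e2]; apply/eqP; apply: contraT => /eqP ne.
  have [a acl Ha] := Hcl k0 i j lti ltj ne.
  by exfalso; apply: (Ha c); rewrite ?mem_cat ?acl ?orbT // e1 e2.
have injfu : {in gtn (size up) &, injective fu}.
  move=> i j; rewrite !inE => lti ltj [e1 e2]; apply/eqP; apply: contraT => /eqP ne.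
  have [a acl Ha] := Hcu i j lti ltj ne.
  by exfalso; apply: (Ha c); rewrite ?mem_cat ?acl ?orbT // e1 e2.
have [B HB] : exists B, forall m, B <= m -> forall n, n \in low ++ up -> n.2 < m.
  elim: (low ++ up) => [|n s [B HB]]; first by exists 0.
  exists (maxn B n.2.+1) => m; rewrite geq_max => /andP[Bm nm] n'.
  by rewrite inE => /orP[/eqP->|/HB]; [exact: nm|exact].
have [j [bj kj Pj]] := decode_large ([seq fl i | i <- iota 0 (size low) & tl i] ++
  [seq fu i | i <- iota 0 (size up) & tu i]) P (maxn b B).
rewrite gtn_max in bj; case/andP: bj => bj Bj.
exists (c, j); split=> // [i k0 lti|i lti].
  rewrite /related /decide /=.
  have -> : (nth ([::], 0) low i).2 < j.
    by apply: (HB _ (ltnW Bj)); rewrite mem_cat mem_nth.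
  rewrite kj mem_cat -/(fl i) mem_selected //; last exact: injfl.
  by rewrite orbC; case: mapP => // -[].
rewrite /related /decide /= ltnNge ltnW /=; last first.
  by apply: (HB _ (ltnW Bj)); rewrite mem_cat mem_nth // orbT.
rewrite kj mem_cat -/(fu i) mem_selected //.
by case: mapP => // -[].
Qed.

(** At level [0] an entry is a single label. The discrete data go into the number and the reals are
    interleaved; positions beyond the length are [false], which makes the code canonical. *)
Definition name_code (X : tower) (n : name) : nat * (nat -> bool) :=
  (enc (n.2, [seq (el X 0 a [::]).1 | a <- n.1]),
   fun p => if dec p is Some (s, q)
            then (el X 0 (nth (0, None) n.1 s) [::]).2 q && (s < size n.1) else false).

Lemma name_code_eq X X' m n : name_code X m = name_code X' n <-> name_eq X X' 0 m n.
Proof.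
split=> [e|[e1 e2 H]].
  have [e1 e2] := enc_inj (congr1 fst e).
  have es : size m.1 = size n.1 by move/(congr1 size): e2; rewrite !size_map.
  split=> //= s lt.
  have := congr1 (nth 0 ^~ s) e2; rewrite !(nth_map (0, None)) -?es // => et.
  have ez : forall q, (el X 0 (nth (0, None) m.1 s) [::]).2 q =
                      (el X' 0 (nth (0, None) n.1 s) [::]).2 q.
    move=> q; have := congr1 (fun w => w.2 (enc (s, q))) e.
    by rewrite /= encK -es lt !andbT.
  move: et ez; case: (el X 0 _ _) (el X' 0 _ _) => [t z] [t' z'] /= -> /funext ->.
  by [].
have et s : s < size m.1 -> el X 0 (nth (0, None) m.1 s) [::] =
    el X' 0 (nth (0, None) n.1 s) [::] by exact: H.
rewrite /name_code e1; congr pair.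
  congr (enc (_, _)); apply: (@eq_from_nth _ 0); rewrite !size_map // => s lt.
  by rewrite !(nth_map (0, None)) -?e2 // et.
apply: funext => p; case: (dec p) => // -[s q].
by rewrite -e2; case: ltnP => [/et ->//|]; rewrite !andbF.
Qed.

(** * Generic enumerations *)

(* [inl (j, q)] is the [q]-th bit of the [j]-th real, [inr (k, i, j)] tells whether the
   [j]-th set of level [k] belongs to the [i]-th set of level [k.+1]. *)
Definition pos : Type := ((nat * nat) + (nat * nat * nat))%type.
Definition pcode (t : pos) : nat := enc t.
Definition pdecode (p : nat) : option pos := dec p.

Lemma pcodeK t : pdecode (pcode t) = Some t. Proof. exact: encK. Qed.

Lemma pdecodeK p t : pdecode p = Some t -> pcode t = p. Proof. exact: decK. Qed.

Definition code_prefix (c : nat) : seq bool :=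
  if (dec c : option (nat * seq nat)) is Some (j, _) then name_prefix j else [::].

Lemma code_prefix_name_code X n : code_prefix (name_code X n).1 = name_prefix n.2.
Proof. by rewrite /code_prefix /= encK. Qed.

(** Compatibility of a finite part [s] of the point with approximations [t] to the reals of index
    below [size t] and with the graph bits fixed by [cst]. *)
Definition respects (s : seq bool) (cst : seq (option bool)) (t : seq (seq bool)) : Prop :=
  forall p, p < size s -> match pdecode p with
  | Some (inl (j, q)) => j < size t -> q < size (nth [::] t j) ->
      nth false s p = nth false (nth [::] t j) q
  | Some (inr _) => forall b, nth None cst p = Some b -> nth false s p = b
  | None => True end.

(** Every bit of these reals occurring in [s] is already decided by [t], so agreement with [t] is
    agreement with the full reals. *)
Definition determined (s : seq bool) (t : seq (seq bool)) : Prop :=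
  forall p j q, p < size s -> pdecode p = Some (inl (j, q)) -> j < size t ->
  q < size (nth [::] t j).

(** Index [0] makes the Mycielski map injective. The other indices say that a condition compatible
    with the given reals extends into [D n] while staying compatible with them. *)
Definition requirement (D : nat -> seq bool -> Prop) (l : nat) (t : seq (seq bool)) : Prop :=
  if l is l'.+1 then
    if (dec l' : option (nat * seq bool * seq (option bool))) is Some (n, s, cst) then
      respects s cst t ->
      exists s', [/\ prefix s s', D n s', respects s' cst t & determined s' t]
    else True
  else size t = 2 -> exists q, [/\ q < size (nth [::] t 0), q < size (nth [::] t 1) &
    nth false (nth [::] t 0) q <> nth false (nth [::] t 1) q].

Lemma bound_below (n : nat) (f : nat -> nat) : exists b, forall i, i < n -> f i < b.
Proof.
have [|b Hb] := @exists_bound n (fun i m => f i < m); last by exists b; exact: Hb.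
by move=> i _; exists (f i).+1.
Qed.

Lemma bound_below2 (n : nat) (g : nat -> nat) (f : nat -> nat -> nat) :
  exists b, forall i j, i < n -> j < g i -> f i j < b.
Proof.
have [|b Hb] := @exists_bound n (fun i m => forall j, j < g i -> f i j < m); last first.
  by exists b => i j lti; exact: Hb.
move=> i _; have [b Hb] := bound_below (g i) (f i).
by exists b => m bm j /Hb lt; exact: leq_trans lt bm.
Qed.

Lemma prefix_mkseq (s : seq bool) (f : nat -> bool) n :
  size s <= n -> extends f s -> prefix s (mkseq f n).
Proof.
move=> le H; rewrite prefixE; apply/eqP; apply: (@eq_from_nth _ false).
  by rewrite size_takel // size_mkseq.
rewrite size_takel ?size_mkseq // => i lt.
by rewrite nth_take // nth_mkseq ?H // (leq_trans lt).
Qed.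

Definition real_index (p : nat) : nat :=
  if pdecode p is Some (inl (_, q)) then q else 0.

Lemma requirement_dense (D : nat -> seq bool -> Prop) l t :
  (forall n s, exists s', prefix s s' /\ D n s') ->
  exists t', [/\ size t' = size t,
    (forall i, prefix (nth [::] t i) (nth [::] t' i)) & requirement D l t'].
Proof.
move=> D_dense; case: l => [|l].
  have [s2|ns2] := eqVneq (size t) 2; last first.
    by exists t; split=> //= [i|/eqP]; [exact: prefix_refl|rewrite (negbTE ns2)].
  case: t s2 => [|a [|b [|]]] // _.
  (* Both strings are brought to length [size a + size b + 1] and differ in the last bit. *)
  exists [:: a ++ (nseq (size b) false ++ [:: false]); b ++ (nseq (size a) false ++ [:: true])].
  split=> // [|_].
    by case=> [|[|[|i]]] //=; exact: prefix_prefix.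
  exists (size a + size b); split=> /=; rewrite ?size_cat ?size_nseq /=.
  - by rewrite addnA addn1.
  - by rewrite addnA addn1 [size b + _]addnC.
  rewrite catA nth_cat size_cat size_nseq ltnn subnn /=.
  by rewrite catA nth_cat size_cat size_nseq [size b + _]addnC ltnn subnn.
rewrite /=; case: (dec l) => [[[n s] cst]|]; last first.
  by exists t; split=> // i; exact: prefix_refl.
have [R|NR] := pselect (respects s cst t); last first.
  by exists t; split=> // i; exact: prefix_refl.
have [N0 HN0] := bound_below2 (size t) (fun j => size (nth [::] t j))
  (fun j q => pcode (inl (j, q))).
(* [N] bounds the positions on which [t] or [cst] imposes a bit; [s1] fills them in before density
   is applied, so the extension [s'] cannot violate them. *)
pose N := maxn (maxn (size s) (size cst)) N0.
pose s1 := mkseq (fun p => if p < size s then nth false s p else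
  match pdecode p with
  | Some (inl (j, q)) => nth false (nth [::] t j) q
  | _ => if nth None cst p is Some b then b else false end) N.
have [s' [s1s' Ds']] := D_dense n s1.
have [B HB] := bound_below (size s') real_index.
(* The reals are prolonged by the bits that [s'] chose for them, up to a length exceeding every bit
   index occurring in [s']. *)
pose t' := mkseq (fun j => mkseq (fun q => if q < size (nth [::] t j)
  then nth false (nth [::] t j) q else nth false s' (pcode (inl (j, q))))
  (maxn B (size (nth [::] t j)))) (size t).
have st' : size t' = size t by rewrite size_mkseq.
have nt' j : j < size t -> nth [::] t' j = mkseq (fun q => if q < size (nth [::] t j)
  then nth false (nth [::] t j) q else nth false s' (pcode (inl (j, q))))
  (maxn B (size (nth [::] t j))) by move=> lt; rewrite nth_mkseq.
have ss1 : prefix s s1.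
  by apply: prefix_mkseq => [|i lt]; rewrite ?lt // /N !leq_max leqnn.
have ls1 p : p < N -> nth false s' p = nth false s1 p.
  by move=> lt; apply: prefix_nth s1s' _; rewrite size_mkseq.
have det : determined s' t'.
  move=> p j q lt e; rewrite st' => ltj; rewrite nt' // size_mkseq leq_max.
  by have := HB p lt; rewrite /real_index e => ->.
exists t'; split=> // [j|_].
  have [ltj|gej] := ltnP j (size t); last by rewrite !nth_default ?st'.
  rewrite nt' //; apply: prefix_mkseq => [|i lt]; last by rewrite lt.
  by rewrite leq_max leqnn orbT.
exists s'; split=> //; first exact: prefix_trans ss1 s1s'.
move=> p lt; have := R p; case e: (pdecode p) => [[[j q]|kij]|] // Rp.
  rewrite st' => ltj; rewrite nt' // size_mkseq => ltq; rewrite nth_mkseq //.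
  case: ifP => ltq'; last by rewrite (pdecodeK e).
  have pN : p < N.
    by rewrite -(pdecodeK e) /N leq_max HN0 // orbT.
  rewrite ls1 // nth_mkseq //; case: ifP => lts; last by rewrite e.
  exact: Rp.
move=> b eb.
have pN : p < N.
  rewrite /N !leq_max; case: (ltnP p (size cst)); rewrite ?orbT // => ge.
  by rewrite nth_default in eb.
rewrite ls1 // nth_mkseq //; case: ifP => lts; last by rewrite e eb.
exact: Rp.
Qed.

(** * Finite states and the run of least choices *)

Definition state : Type := (seq bool * seq (nat * name))%type.

Definition lev (L : seq (nat * name)) (k : nat) : seq name := [seq a.2 | a <- L & a.1 == k].

Definition name_at (L : seq (nat * name)) (k j : nat) : name := nth ([::], 0) (lev L k) j.

Lemma lev_cat L M k : lev (L ++ M) k = lev L k ++ lev M k.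
Proof. by rewrite /lev filter_cat map_cat. Qed.

Lemma lev_rcons L a k : lev (rcons L a) k = if a.1 == k then rcons (lev L k) a.2 else lev L k.
Proof. by rewrite -cats1 lev_cat {2}/lev /=; case: ifP; rewrite ?cats0 ?cats1. Qed.

Definition pos_val (phi : nat * (nat -> bool) -> nat -> bool) (X : tower)
    (L : seq (nat * name)) (p : nat) : option bool :=
  match pdecode p with
  | Some (inl (j, q)) => if j < size (lev L 0)
      then Some (phi (name_code X (name_at L 0 j)) q) else None
  | Some (inr (k, i, j)) => if (j < size (lev L k)) && (i < size (lev L k.+1))
      then Some (related X k (name_at L k j) (name_at L k.+1 i)) else None
  | None => None
  end.

Definition distinct (X : tower) (L : seq (nat * name)) : bool :=
  pairwise (fun a b => ~~ ((a.1 == b.1) && `[< name_eq X X a.1 a.2 b.2 >])) L.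

Definition coherent phi X (st : state) : bool :=
  all (fun p => (pdecode p == None) || (pos_val phi X st.2 p == Some (nth false st.1 p)))
    (iota 0 (size st.1)).

Definition listed (X : tower) (L : seq (nat * name)) (n : nat) : bool :=
  if (dec n : option (nat * name)) is Some (k, nu)
  then has (fun a => (a.1 == k) && `[< name_eq X X k a.2 nu >]) L else true.

Definition valid phi X (st : state) : bool := coherent phi X st && distinct X st.2.

Definition next_state phi (D : nat -> seq bool -> Prop) X (n : nat) (st st' : state) : bool :=
  [&& prefix st.1 st'.1, prefix st.2 st'.2, valid phi X st', `[< D n st'.1 >] & listed X st'.2 n].

Definition first_state phi (s0 : seq bool) X (st : state) : bool :=
  prefix s0 st.1 && valid phi X st.

Definition decoded (T : countType) (Q : T -> bool) (n : nat) : bool :=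
  if dec n is Some t then Q t else false.

(** Taking the least code, instead of an arbitrary choice, makes the selected object depend on [Q]
    in a Borel way. *)
Definition least (T : countType) (t0 : T) (Q : T -> bool) : T :=
  match pselect (exists n, decoded Q n) with
  | left h => odflt t0 (dec (ex_minn h))
  | right _ => t0
  end.

Lemma leastP (T : countType) (t0 : T) (Q : T -> bool) : (exists t, Q t) -> Q (least t0 Q).
Proof.
move=> [t Qt]; rewrite /least; case: pselect => [h|[]]; last first.
  by exists (enc t); rewrite /decoded encK.
by case: ex_minnP => n; rewrite /decoded; case: (dec n).
Qed.

Fixpoint run phi (D : nat -> seq bool -> Prop) s0 X (n : nat) : state :=
  if n is m.+1 then least ([::], [::]) (next_state phi D X m (run phi D s0 X m))
  else least ([::], [::]) (first_state phi s0 X).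

Definition generic_code phi D s0 X (p : nat) : bool :=
  nth false (run phi D s0 X p.+1).1 p.

(** Weaker than coherence: positions about names not yet listed stay free. *)
Definition agree phi X (s : seq bool) (L : seq (nat * name)) : Prop :=
  forall p b, p < size s -> pos_val phi X L p = Some b -> nth false s p = b.

Lemma distinct_lev X L k : distinct X L -> distinct_names X k (lev L k).
Proof.
move=> dL.
have pw : pairwise (fun m n => ~~ `[< name_eq X X k m n >]) (lev L k).
  rewrite /lev pairwise_map.
  have := pairwise_filter (fun a : nat * name => a.1 == k) dL.
  apply: (sub_in_pairwise (P := fun a : nat * name => a.1 == k)); last exact: filter_all.
  by move=> a b /eqP ea /eqP eb; rewrite ea eb eqxx.
have lt_neq i j : i < j -> j < size (lev L k) ->
    ~ name_eq X X k (nth ([::], 0) (lev L k) i) (nth ([::], 0) (lev L k) j).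
  move=> ij ltj; move/(pairwiseP ([::], 0)): pw => /(_ i j).
  rewrite !inE => /(_ (ltn_trans ij ltj) ltj ij) /negP H.
  by move=> /asboolP.
move=> i j lti ltj ne; have [ij|ji|//] := ltngtP i j; first exact: lt_neq.
by move=> /name_eq_sym; exact: lt_neq.
Qed.

Lemma coherentP phi X s L : reflect
  (forall p, p < size s -> pdecode p = None \/ pos_val phi X L p = Some (nth false s p))
  (coherent phi X (s, L)).
Proof.
apply: (iffP allP) => H p.
  by move=> lt; have := H p; rewrite mem_iota /= add0n lt => /(_ isT) /orP[/eqP|/eqP]; auto.
rewrite mem_iota /= add0n => /H[->|->]; by rewrite eqxx ?orbT.
Qed.

Lemma coherent_agree phi X s L : coherent phi X (s, L) -> agree phi X s L.
Proof.
move=> /coherentP H p b lt; have [e|->] := H p lt; last by case.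
by rewrite /pos_val e.
Qed.

Lemma name_at_cat L M k j : j < size (lev L k) -> name_at (L ++ M) k j = name_at L k j.
Proof. by move=> lt; rewrite /name_at lev_cat nth_cat lt. Qed.

Lemma lev_prefix_size L L' k : prefix L L' -> size (lev L k) <= size (lev L' k).
Proof. by move=> /prefixP[M ->]; rewrite lev_cat size_cat leq_addr. Qed.

Lemma pos_val_prefix phi X L L' p b :
  prefix L L' -> pos_val phi X L p = Some b -> pos_val phi X L' p = Some b.
Proof.
move=> LL'; have lep k := lev_prefix_size k LL'; move/prefixP: LL' lep => [M ->] lep.
rewrite /pos_val; case: (pdecode p) => [[[j q]|[[k i] j]]|] //.
  by case: ifP => // lt; rewrite (leq_trans lt (lep _)) name_at_cat.
case: ifP => // /andP[ltj lti].
by rewrite (leq_trans ltj (lep _)) (leq_trans lti (lep _)) !name_at_cat.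
Qed.

Lemma coherent_prefix phi X s L L' :
  prefix L L' -> coherent phi X (s, L) -> coherent phi X (s, L').
Proof.
move=> LL' /coherentP H; apply/coherentP => p /H[e|e]; [by left|right].
exact: pos_val_prefix e.
Qed.

Lemma level_bound (L : seq (nat * name)) :
  exists N, forall k, 0 < size (lev L k) -> k < N.
Proof.
elim: L => [|a L [N HN]]; first by exists 0.
exists (maxn N a.1.+1) => k; rewrite leq_max /lev /=.
by case: eqP => [->|_ /HN ->]; rewrite ?leqnn ?orbT.
Qed.

Section Run.
Variables (phi : nat * (nat -> bool) -> nat -> bool).
Variables (D : nat -> seq bool -> Prop) (s0 : seq bool) (X : tower).
Hypothesis phi_prefix : forall c z, extends (phi (c, z)) (code_prefix c).
Hypothesis phi_generic : forall l (ws : seq (nat * (nat -> bool))) w0,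
  (forall i j, i < size ws -> j < size ws -> nth w0 ws i = nth w0 ws j -> i = j) ->
  exists t, [/\ size t = size ws,
    (forall i, i < size t -> extends (phi (nth w0 ws i)) (nth [::] t i)) & requirement D l t].
Hypothesis D_size : forall n s, D n s -> n < size s.

(** The bits of [s] may already speak about the next name of level [k]. The extension property
    realises what they prescribe: its relations to the listed names of the adjacent levels and, at
    level [0], the first bits of its real. *)
Lemma add_fresh s L k : agree phi X s L -> distinct X L ->
  exists nu, agree phi X s (rcons L (k, nu)) /\ distinct X (rcons L (k, nu)).
Proof.
move=> aL dL; pose j0 := size (lev L k).
have [B HB] := bound_below (size s) real_index.
have [b Hb] : exists b, forall a, a \in L -> a.2.2 <= b.
  elim: (L) => [|a M [b Hb]]; first by exists 0.
  exists (maxn a.2.2 b) => a'; rewrite inE => /orP[/eqP->|/Hb le]; first exact: leq_maxl.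
  by rewrite leq_max le orbT.
have [nu [bnu Pnu Hl Hu]] := @fresh_name X k (lev L k.-1) (lev L k.+1)
  (fun i => nth false s (pcode (inr (k.-1, j0, i))))
  (fun i => nth false s (pcode (inr (k, i, j0))))
  (mkseq (fun q => nth false s (pcode (inl (j0, q)))) B) b
  (fun _ => distinct_lev (k := k.-1) dL) (distinct_lev (k := k.+1) dL).
have old k' j : j < size (lev L k') -> name_at (rcons L (k, nu)) k' j = name_at L k' j.
  by rewrite -cats1; exact: name_at_cat.
have new : name_at (rcons L (k, nu)) k j0 = nu.
  by rewrite /name_at lev_rcons eqxx nth_rcons ltnn eqxx.
have sz k' j : j < size (lev (rcons L (k, nu)) k') ->
    j < size (lev L k') \/ (k' = k /\ j = j0).
  rewrite lev_rcons; case: eqP => [<-|_]; last by left.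
  by rewrite size_rcons ltnS leq_eqVlt => /orP[/eqP|]; [right|left].
exists nu; split; last first.
  rewrite /distinct pairwise_rcons; apply/andP; split=> //.
  apply/allP => a aL'; apply/negP => /andP[/= _ /asboolP[e _ _]].
  by have := Hb a aL'; rewrite e leqNgt bnu.
move=> p c lt; rewrite /pos_val; case e: (pdecode p) => [[[j q]|[[k' i] j]]|] //.
  case: ifP => // /sz[ltj|[k0 ej]].
    by rewrite old // => -[<-]; apply: aL => //; rewrite /pos_val e ltj.
  have -> : name_at (rcons L (k, nu)) 0 j = nu by rewrite ej -[RHS]new; congr name_at.
  move=> [<-]; rewrite -(pdecodeK e) ej.
  have ltq : q < B by have := HB p lt; rewrite /real_index e.
  have := @phi_prefix (name_code X nu).1 (name_code X nu).2 q.
  by rewrite code_prefix_name_code Pnu size_mkseq ltq nth_mkseq // => ->.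
case: ifP => // /andP[/sz[ltj|[ek ej]] /sz[lti|[ek' ei]]].
- by rewrite !old // => -[<-]; apply: aL => //; rewrite /pos_val e ltj lti.
- have -> : name_at (rcons L (k, nu)) k'.+1 i = nu by rewrite ei -[RHS]new ek'.
  rewrite old // => -[<-]; rewrite -(pdecodeK e) ei.
  by have := Hl j; rewrite -ek' /= => /(_ isT ltj) <-.
- have -> : name_at (rcons L (k, nu)) k' j = nu by rewrite ej -[RHS]new ek.
  rewrite old // => -[<-]; rewrite -(pdecodeK e) ej.
  by have := Hu i; rewrite -ek => /(_ lti) <-.
by rewrite ek in ek'; move/esym/n_Sn: ek'.
Qed.

Lemma add_fresh_levels s (ks : seq nat) L : agree phi X s L -> distinct X L ->
  exists L', [/\ prefix L L', agree phi X s L', distinct X L' &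
    forall k, count_mem k ks <= size (lev L' k)].
Proof.
elim: ks L => [|k ks IH] L aL dL; first by exists L; split=> //; exact: prefix_refl.
have [L1 [LL1 aL1 dL1 H1]] := IH L aL dL.
have [nu [aL2 dL2]] := add_fresh k aL1 dL1.
exists (rcons L1 (k, nu)); split=> // [|k'].
  by rewrite -cats1; exact: prefix_trans LL1 (prefix_prefix _ _).
rewrite lev_rcons /=; case: eqP => [<-|_]; last exact: H1.
by rewrite size_rcons ltnS.
Qed.

(** Once every level mentioned in [s] has enough names, no position of [s] is left without a
    value. *)
Lemma fill s L : agree phi X s L -> distinct X L ->
  exists L', [/\ prefix L L', coherent phi X (s, L') & distinct X L'].
Proof.
move=> aL dL.
have [N HN] := bound_below (size s) (fun p => match pdecode p with
  | Some (inl (j, q)) => j.+1 | Some (inr (k, i, j)) => (k.+2 + i + j).+1 | None => 0 end).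
have [L' [LL' aL' dL' H]] := add_fresh_levels (flatten [seq nseq N k | k <- iota 0 N]) aL dL.
have sz k : k < N -> N <= size (lev L' k).
  move=> lt; apply: leq_trans (H k).
  have /splitPr[ks1 ks2] : k \in iota 0 N by rewrite mem_iota add0n.
  rewrite map_cat flatten_cat count_cat /= count_cat count_nseq /= eqxx mul1n.
  by rewrite addnCA leq_addr.
exists L'; split=> //; apply/coherentP => p lt.
case e: (pdecode p) => [t|]; last by left.
right; have := HN p lt; rewrite e => ltN.
suff [b eb] : exists b, pos_val phi X L' p = Some b by rewrite eb (aL' p b lt eb).
rewrite /pos_val e; case: t e ltN => [[j q]|[[k i] j]] e ltN.
  have lt0 : j < size (lev L' 0) by apply: leq_trans (sz 0 _); lia.
  by rewrite lt0; eexists.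
have -> : j < size (lev L' k) by apply: leq_trans (sz k _); lia.
have -> : i < size (lev L' k.+1) by apply: leq_trans (sz k.+1 _); lia.
by eexists.
Qed.

(** The reals of the listed names of level [0] are images of distinct codes, hence mutually generic,
    and the requirement for [(n, s, cst)] yields an extension compatible both with these reals and
    with the graph bits determined by [L]. *)
Lemma generic_extension n s L : coherent phi X (s, L) -> distinct X L ->
  exists s', [/\ prefix s s', D n s' & agree phi X s' L].
Proof.
move=> cL dL; have aL := coherent_agree cL.
pose ws := [seq name_code X m | m <- lev L 0].
have ws_nth i : i < size ws -> nth (0, fun=> false) ws i = name_code X (name_at L 0 i).
  by rewrite size_map => lt; rewrite (nth_map ([::], 0)).
have ws_inj i j : i < size ws -> j < size ws ->
    nth (0, fun=> false) ws i = nth (0, fun=> false) ws j -> i = j.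
  move=> lti ltj; rewrite !ws_nth // => /name_code_eq e; rewrite size_map in lti ltj.
  apply/eqP; apply: contraT => /eqP ne.
  by have := @distinct_lev X L 0 dL i j lti ltj ne e.
have [K HK] := level_bound L.
have [N HN] : exists N, forall k, k < K -> forall i j, i < size L -> j < size L ->
    pcode (inr (k, i, j)) < N.
  have [|N HN] := @exists_bound K (fun k m => forall i j, i < size L -> j < size L ->
    pcode (inr (k, i, j)) < m); last by exists N; exact: HN.
  move=> k _; have [b Hb] := bound_below2 (size L) (fun=> size L)
    (fun i j => pcode (inr (k, i, j))).
  by exists b => m bm i j lti ltj; exact: leq_trans (Hb _ _ lti ltj) bm.
have szL k : size (lev L k) <= size L.
  by rewrite size_map size_filter count_size.
(* The bits forced by the listed names; [N] exceeds every graph position between them. *)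
pose cst := mkseq (pos_val phi X L) N.
have [t [st Ht]] := phi_generic (enc (n, s, cst)).+1 ws_inj.
rewrite /requirement encK => req.
have bit j q : j < size t -> q < size (nth [::] t j) ->
    nth false (nth [::] t j) q = phi (name_code X (name_at L 0 j)) q.
  by move=> ltj ltq; rewrite (Ht j ltj q ltq) ws_nth // -st.
have lt0 j : (j < size t) = (j < size (lev L 0)) by rewrite st size_map.
have [|s' [ss' Ds' Rs' det]] := req.
  move=> p lt; case e: (pdecode p) => [[[j q]|[[k i] j]]|] //.
    move=> ltj ltq; rewrite bit //; apply: aL => //.
    by rewrite /pos_val e -lt0 ltj.
  move=> b; have [ltN|geN] := ltnP p N; last by rewrite nth_default ?size_mkseq.
  by rewrite nth_mkseq // => /aL; apply.
exists s'; split=> // p b lt; have := Rs' p lt; have := det p.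
case e: (pdecode p) => [[[j q]|[[k i] j]]|]; rewrite {1}/pos_val e //.
  move=> /(_ j q lt erefl) det' Rp; case: ifP => //; rewrite -lt0 => ltj [<-].
  by rewrite Rp ?det' // bit // det'.
move=> _ Rp; case: ifP => // /andP[ltj lti] eb; apply: Rp.
rewrite nth_mkseq; first by rewrite /pos_val e ltj lti.
rewrite -(pdecodeK e); apply: HN; first by apply: HK; exact: leq_ltn_trans ltj.
  exact: leq_trans lti (szL _).
exact: leq_trans ltj (szL _).
Qed.

Lemma list_name n s L : valid phi X (s, L) ->
  exists L', [/\ prefix L L', valid phi X (s, L') & listed X L' n].
Proof.
move=> vL; rewrite /listed; case: dec => [[k nu]|]; last first.
  by exists L; split=> //; exact: prefix_refl.
have [h|/negP nh] := boolP (has (fun a => (a.1 == k) && `[< name_eq X X k a.2 nu >]) L).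
  by exists L; split=> //; exact: prefix_refl.
have pL : prefix L (rcons L (k, nu)) by rewrite -cats1; exact: prefix_prefix.
exists (rcons L (k, nu)); split=> //; last first.
  by rewrite has_rcons /= eqxx; apply/orP; left; apply/asboolP; exact: name_eq_refl.
case/andP: vL => cL dL; rewrite /valid (coherent_prefix pL cL) /= /distinct pairwise_rcons.
rewrite -/(distinct X L) dL andbT; apply/allP => a aL; apply/negP => /andP[/= /eqP e na].
by apply: nh; apply/hasP; exists a => //; rewrite e eqxx /= -e.
Qed.

(** The [n]-th name is listed first, then [D n] is entered with the listed names fixed, and finally
    fresh names account for the new bits. *)
Lemma next_state_exists n st : valid phi X st -> exists st', next_state phi D X n st st'.
Proof.
case: st => s L vL; have [L1 [LL1 /andP[cL1 dL1] lL1]] := list_name n vL.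
have [s' [ss' Ds' aL1]] := generic_extension n cL1 dL1.
have [L2 [L12 cL2 dL2]] := fill aL1 dL1.
exists (s', L2); rewrite /next_state /valid /= ss' (prefix_trans LL1 L12) cL2 dL2 /=.
apply/andP; split; first exact/asboolP.
move: lL1; rewrite /listed; case: dec => // -[k nu] /hasP[a aL1' Ha].
by apply/hasP; exists a => //; move/prefixP: L12 => [M ->]; rewrite mem_cat aL1'.
Qed.

Lemma first_state_exists : exists st, first_state phi s0 X st.
Proof.
have [|L [_ cL dL]] := @fill s0 [::] _ isT.
  by move=> p b _; rewrite /pos_val; case: (pdecode p) => [[[j q]|[[k i] j]]|].
by exists (s0, L); rewrite /first_state /valid prefix_refl cL dL.
Qed.

Let st := run phi D s0 X.

Lemma run_valid n : valid phi X (st n).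
Proof.
elim: n => [|n IH].
  have := leastP ([::], [::]) first_state_exists.
  by rewrite /first_state => /andP[].
have := leastP ([::], [::]) (next_state_exists n IH).
by rewrite /next_state => /and5P[].
Qed.

Lemma run_next n : next_state phi D X n (st n) (st n.+1).
Proof. exact: leastP (next_state_exists n (run_valid n)). Qed.

Lemma run_prefix m n : m <= n -> prefix (st m).1 (st n).1 /\ prefix (st m).2 (st n).2.
Proof.
move=> /subnK <-; elim: (n - m) => [|d [IH1 IH2]]; first by rewrite !prefix_refl.
have /and5P[p1 p2 _ _ _] := run_next (d + m).
by split; [exact: prefix_trans IH1 p1|exact: prefix_trans IH2 p2].
Qed.

Let y := generic_code phi D s0 X.

Lemma run_size n : n < size (st n.+1).1.
Proof. by have /and5P[_ _ _ /asboolP Dn _] := run_next n; exact: D_size Dn. Qed.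

Lemma run_extends n : extends y (st n).1.
Proof.
move=> p lt; rewrite /y /generic_code -/st.
have [le|le] := leqP n p.+1.
  by rewrite (prefix_nth _ (run_prefix le).1).
by rewrite (prefix_nth _ (run_prefix (ltnW le)).1) // run_size.
Qed.

Lemma generic_code_extends : extends y s0.
Proof.
have p0 : prefix s0 (st 0).1 by have /andP[] := leastP ([::], [::]) first_state_exists.
exact: extends_prefix p0 (@run_extends 0).
Qed.

Lemma generic_code_generic n : exists s, extends y s /\ D n s.
Proof.
exists (st n.+1).1; split; first exact: run_extends.
by have /and5P[_ _ _ /asboolP] := run_next n.
Qed.

Lemma run_pos_val t : exists n, pos_val phi X (st n).2 (pcode t) = Some (y (pcode t)).
Proof.
exists (pcode t).+1; have /andP[+ _] := run_valid (pcode t).+1.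
rewrite [st _]surjective_pairing => /coherentP /(_ _ (run_size _)).
by rewrite pcodeK => -[//|->]; rewrite run_extends // run_size.
Qed.

(** At this stage the bit [inr (k, 0, j)] is present, and coherence gives it a value only if the
    [j]-th name of level [k] is listed; no default is read. *)
Definition enumerated (k j : nat) : name := name_at (st (pcode (inr (k, 0, j))).+1).2 k j.

Lemma enumeratedE n k j : j < size (lev (st n).2 k) -> name_at (st n).2 k j = enumerated k j.
Proof.
move=> lt; rewrite /enumerated; set m := (pcode _).+1.
have lt' : j < size (lev (st m).2 k).
  have /andP[+ _] := run_valid m.
  rewrite [st _]surjective_pairing => /coherentP /(_ _ (run_size _)).
  by rewrite pcodeK /pos_val pcodeK => -[//|]; case: ifP => // /andP[].
have [/run_prefix[_ /prefixP[M e]]|/ltnW /run_prefix[_ /prefixP[M e]]] := leqP m n.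
  by rewrite e name_at_cat.
by rewrite e name_at_cat.
Qed.

Lemma generic_code_real j q :
  y (pcode (inl (j, q))) = phi (name_code X (enumerated 0 j)) q.
Proof.
have [n] := run_pos_val (inl (j, q)); rewrite /pos_val pcodeK.
by case: ifP => // lt [<-]; rewrite enumeratedE.
Qed.

Lemma generic_code_related k i j :
  y (pcode (inr (k, i, j))) = related X k (enumerated k j) (enumerated k.+1 i).
Proof.
have [n] := run_pos_val (inr (k, i, j)); rewrite /pos_val pcodeK.
by case: ifP => // /andP[ltj lti] [<-]; rewrite !enumeratedE.
Qed.

Lemma enumerated_onto k nu : exists j, name_eq X X k (enumerated k j) nu.
Proof.
have /and5P[_ _ _ _] := run_next (enc (k, nu)).
rewrite /listed encK => /hasP[a aL /andP[/eqP ak /asboolP e]].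
set n := (enc _).+1 in aL.
have al : a.2 \in lev (st n).2 k by apply/mapP; exists a => //; rewrite mem_filter ak eqxx.
exists (index a.2 (lev (st n).2 k)).
by rewrite -(@enumeratedE n) ?index_mem // /name_at nth_index.
Qed.

End Run.

(** * Sets coded by a point of the Cantor space *)

Definition real_at (y : nat -> bool) (j : nat) : nat -> bool := fun q => y (pcode (inl (j, q))).

Section Content.
Variables (R : numDomainType) (emb : (nat -> bool) -> R).
Hypotheses (emb_inj : injective emb) (emb_ge0 : forall u, (0 <= emb u)%R).

(* Non-members are replaced by a hereditarily constant set over a negative real, chosen
   differently at each level so that it is not the code of a genuine element. *)
Fixpoint content (y : nat -> bool) (k j : nat) : seq nat -> R :=
  if k is k'.+1 then fun q =>
    if q is i :: q' then
      if y (pcode (inr (k', j, i))) then content y k' i q' else (- k'.+1%:R)%R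
    else 0%R
  else fun=> emb (real_at y j).

(** The set of all sets of level [n - 1] coded by [y]; for [n = 0] a constant without
    information. *)
Definition contents (y : nat -> bool) (n : nat) : seq nat -> R :=
  if n is k.+1 then fun q => if q is i :: q' then content y k i q' else 0%R else fun=> 0%R.

Lemma tree_eq_cst k (a b : R) : tree_eq k (fun=> a) (fun=> b) <-> a = b.
Proof.
elim: k => [|k IH] //=; split=> [[/(_ 0)[_ /IH]] //|e].
by split=> i; exists 0; apply/IH.
Qed.

(** Induction on [k]: reals are sent to non-negative values, and a child is either a genuine content
    or a dummy of absolute value below [c]. *)
Lemma content_neq_dummy y k j c : k < c -> ~ tree_eq k (content y k j) (fun=> (- c%:R)%R).
Proof.
elim: k j c => [|k IH] j c lt /=.
  move=> e; have := emb_ge0 (real_at y j); rewrite e oppr_ge0 => le.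
  by have := ltr0n R c; rewrite lt => /(le_lt_trans le); rewrite ltxx.
move=> [/(_ 0)[i] + _]; rewrite /child; case: (y _); first exact/IH/ltnW.
move=> /tree_eq_cst /oppr_inj /eqP; rewrite eqr_nat => /eqP e.
by rewrite -e ltnn in lt.
Qed.

Lemma content_child y k j i : child (content y k.+1 j) i =
  if y (pcode (inr (k, j, i))) then content y k i else fun=> (- k.+1%:R)%R.
Proof. by rewrite /child /=; case: ifP. Qed.

Lemma content_sub y y' k j j' : tree_eq k.+1 (content y k.+1 j) (content y' k.+1 j') ->
  forall i, y (pcode (inr (k, j, i))) ->
  exists2 i', y' (pcode (inr (k, j', i'))) & tree_eq k (content y k i) (content y' k i').
Proof.
move=> [H _] i yi; have [i'] := H i; rewrite !content_child yi.
by case: ifP => [y'i' e|_ /content_neq_dummy]; [exists i'|case/(_ (ltnSn k))].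
Qed.

Variable phi : nat * (nat -> bool) -> nat -> bool.
Hypothesis phi_inj : injective phi.

Definition encodes (X : tower) (y : nat -> bool) (e : nat -> nat -> name) : Prop :=
  [/\ forall j q, y (pcode (inl (j, q))) = phi (name_code X (e 0 j)) q,
      forall k i j, y (pcode (inr (k, i, j))) = related X k (e k j) (e k.+1 i) &
      forall k nu, exists j, name_eq X X k (e k j) nu].

Definition sub_level (X X' : tower) (k : nat) : Prop :=
  forall a, exists a', tree_eq k (el X k a) (el X' k a').

Lemma sub_level_name X X' k nu : sub_level X X' k -> exists nu', name_eq X X' k nu nu'.
Proof.
move=> /choice[f Hf]; exists ([seq f a | a <- nu.1], nu.2); split=> //= [|s lt].
  by rewrite size_map.
by rewrite (nth_map (0, None)).
Qed.

(** Names over [X] and [X'] with equal entries correspond to each other, and [related] depends on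
    the entries only, so the members match level by level. *)
Lemma content_eq X X' y y' e e' :
  encodes X y e -> encodes X' y' e' ->
  (forall k, sub_level X X' k) -> (forall k, sub_level X' X k) ->
  forall k j j', name_eq X X' k (e k j) (e' k j') ->
  tree_eq k (content y k j) (content y' k j').
Proof.
move=> [er ee eo] [er' ee' eo'] s1 s2; elim=> [|k IH] j j' en.
  move/name_code_eq: en => en /=; congr emb; apply: funext => q.
  by rewrite /real_at er er' en.
split=> i; rewrite !content_child.
  have [nu en1] := sub_level_name (e k i) (s1 k).
  have [i' en2] := eo' k nu; exists i'; rewrite content_child.
  have en3 := name_eq_trans en1 (name_eq_sym en2).
  rewrite ee ee' (related_eq en3 en); case: ifP => _; last exact: tree_eq_refl.
  exact: IH.
have [nu en1] := sub_level_name (e' k i) (s2 k).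
have [i' en2] := eo k nu; exists i'; rewrite content_child.
have en3 := name_eq_sym (name_eq_trans en1 (name_eq_sym en2)).
rewrite ee ee' (related_eq en3 en); case: ifP => _; last exact: tree_eq_refl.
exact: IH.
Qed.

(** Take a number larger than both, whose table accepts only the key of the first pair. *)
Lemma decide_separates M M' i i' : (M, i) <> (M', i') ->
  exists j, decide M j i /\ ~~ decide M' j i'.
Proof.
move=> ne; have [j [bj kj _]] := decode_large [:: (true, M, i)] [::] (maxn i i').
rewrite gtn_max in bj; case/andP: bj => ij ij'; exists j.
rewrite /decide !ltnNge (ltnW ij) (ltnW ij') /= kj !inE eqxx; split=> //.
by apply/negP => /eqP[e1 e2]; apply: ne; rewrite e1 e2.
Qed.

(** If no counterpart of [a] sees the second upper name as [a] sees the first, some one-entry name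
    over [a] belongs to the first set while its counterparts do not belong to the second. *)
Lemma content_names_sub X X' y y' e e' k j j' :
  encodes X y e -> encodes X' y' e' ->
  (forall i i', tree_eq k (content y k i) (content y' k i') ->
                name_eq X X' k (e k i) (e' k i')) ->
  tree_eq k.+1 (content y k.+1 j) (content y' k.+1 j') ->
  forall a, (forall a', tree_eq k (el X k a) (el X' k a') ->
    (matrix_of X k [:: a] (e k.+1 j).1, (e k.+1 j).2) <>
    (matrix_of X' k [:: a'] (e' k.+1 j').1, (e' k.+1 j').2)) -> False.
Proof.
move=> [er ee eo] [er' ee' eo'] IH Hc a Ha.
have Mcong a' : tree_eq k (el X k a) (el X' k a') -> forall a'',
    tree_eq k (el X k a) (el X' k a'') ->
    matrix_of X' k [:: a'] (e' k.+1 j').1 = matrix_of X' k [:: a''] (e' k.+1 j').1.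
  move=> e1 a'' e2; apply: matrix_of_eq => // [[|i] //= _|i _]; last exact: tree_eq_refl.
  exact: tree_eq_trans (tree_eq_sym e1) e2.
have [n [dn dn']] : exists n, decide (matrix_of X k [:: a] (e k.+1 j).1) n (e k.+1 j).2 /\
    forall a', tree_eq k (el X k a) (el X' k a') ->
    ~~ decide (matrix_of X' k [:: a'] (e' k.+1 j').1) n (e' k.+1 j').2.
  have [[a1 e1]|no] := pselect (exists a', tree_eq k (el X k a) (el X' k a')).
    have [n [dn dn']] := decide_separates (Ha a1 e1); exists n; split=> // a2 e2.
    by rewrite -(Mcong a1 e1 a2 e2).
  (* When [a] has no counterpart only the positive half matters; the second pair is an arbitrary
     different one. *)
  have [|n [dn _]] := @decide_separates (matrix_of X k [:: a] (e k.+1 j).1)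
    (matrix_of X k [:: a] (e k.+1 j).1) (e k.+1 j).2 (e k.+1 j).2.+1.
    by move=> [/n_Sn].
  by exists n; split=> // a' e1; exfalso; apply: no; exists a'.
have [i ei] := eo k ([:: a], n).
have yi : y (pcode (inr (k, j, i))).
  by rewrite ee (related_eq ei (name_eq_refl _ _ _)).
have [i' y'i' /IH en] := content_sub Hc yi.
have [e1 e2 e3] := name_eq_trans (name_eq_sym ei) en.
move: y'i'; rewrite ee'; move: e1 e2 e3; case: (e' k i') => -[|a' [|]] //= m <- _ /(_ 0 isT) /=.
by move=> /dn' /negbTE; rewrite /related /= => ->.
Qed.

(** By induction the members can be compared as names. One-entry members then force equal numbers
    and equal lengths, and they reveal which elements belong to each entry, so corresponding entries
    are equal. *)
Lemma content_names X X' y y' e e' : encodes X y e -> encodes X' y' e' ->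
  forall k j j', tree_eq k (content y k j) (content y' k j') ->
  name_eq X X' k (e k j) (e' k j').
Proof.
move=> E E'; have [er _ _] := E; have [er' _ _] := E'; elim=> [|k IH] j j' Hc.
  apply/name_code_eq/phi_inj/funext => q; rewrite -er -er'.
  exact: (congr1 (@^~ q) (emb_inj Hc)).
have H1 := content_names_sub E E' IH Hc.
have H2 := content_names_sub E' E
  (fun i i' h => name_eq_sym (IH i' i (tree_eq_sym h))) (tree_eq_sym Hc).
apply: contrapT => /name_neq_cases[ne|[ne|[es [s lts ne]]]].
- by apply: (H1 (0, None)) => a' _ /(congr1 snd).
- by apply: (H1 (0, None)) => a' _ /(congr1 (fun P => size (nth [::] P.1 0))) /=; rewrite !size_map.
apply: ne; split=> i.
  have [a Ha] := el_transitive X k (nth (0, None) (e k.+1 j).1 s) i.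
  apply: contrapT => /forallNP no; apply: (H1 a) => a' eaa'.
  move=> /(congr1 (fun P => nth false (nth [::] P.1 0) s)) /=.
  rewrite !(nth_map (0, None)) -?es // => eb.
  have : el_mem X k a (nth (0, None) (e k.+1 j).1 s) by exists i.
  move=> /asboolP; rewrite eb => /asboolP[i' Hi'].
  apply: (no i'); apply: tree_eq_trans (tree_eq_sym Ha) (tree_eq_trans eaa' Hi').
have [a Ha] := el_transitive X' k (nth (0, None) (e' k.+1 j').1 s) i.
apply: contrapT => /forallNP no; apply: (H2 a) => a' eaa'.
move=> /(congr1 (fun P => nth false (nth [::] P.1 0) s)) /=.
rewrite !(nth_map (0, None)) -?es // => eb.
have : el_mem X' k a (nth (0, None) (e' k.+1 j').1 s) by exists i.
move=> /asboolP; rewrite eb => /asboolP[i' Hi'].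
apply: (no i'); apply: tree_eq_sym.
exact: tree_eq_trans (tree_eq_sym Ha) (tree_eq_trans eaa' Hi').
Qed.

Lemma contents_eq X X' y y' e e' n :
  encodes X y e -> encodes X' y' e' ->
  (forall k, sub_level X X' k) -> (forall k, sub_level X' X k) ->
  tree_eq n (contents y n) (contents y' n).
Proof.
move=> E E' s1 s2; have [_ _ eo] := E; have [_ _ eo'] := E'.
case: n => [|k] //; split=> i.
  have [nu en1] := sub_level_name (e k i) (s1 k); have [j en2] := eo' k nu.
  by exists j; exact: content_eq E E' s1 s2 _ _ _ (name_eq_trans en1 (name_eq_sym en2)).
have [nu en1] := sub_level_name (e' k i) (s2 k); have [j en2] := eo k nu.
exists j; apply: content_eq E E' s1 s2 _ _ _ _.
exact: name_eq_sym (name_eq_trans en1 (name_eq_sym en2)).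
Qed.

(** The element [a] is carried by the one-entry name [([:: a], 0)], whose content recurs in the
    second set. *)
Lemma contents_sub_level X X' y y' e e' k :
  encodes X y e -> encodes X' y' e' ->
  tree_eq k.+1 (contents y k.+1) (contents y' k.+1) -> sub_level X X' k.
Proof.
move=> E E' [H _] a; have [_ _ eo] := E.
have [j en] := eo k ([:: a], 0); have [j' Hj'] := H j.
have := name_eq_trans (name_eq_sym en) (content_names E E' Hj').
by case: (e' k j') => s m [_ /= es /(_ 0 isT) /= h]; exists (nth (0, None) s 0).
Qed.

End Content.

Local Open Scope classical_set_scope.

(** * Borel dependence *)

Section BorelSets.
Variable X : topologicalType.

Lemma borel_open (A : set X) : open A -> borel A.
Proof. by move=> oA; exact: sub_sigma_algebra. Qed.

Lemma borel_setC (A : set X) : borel A -> borel (~` A).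
Proof.
by rewrite -setTD; have [_ + _] := smallest_sigma_algebra [set: X] (@open X); exact.
Qed.

Lemma borel_bigcup (A : nat -> set X) : (forall n, borel (A n)) -> borel (\bigcup_n A n).
Proof. by have [_ _] := smallest_sigma_algebra [set: X] (@open X); exact. Qed.

Lemma borel_not (P : X -> Prop) : borel [set x | P x] -> borel [set x | ~ P x].
Proof. exact: borel_setC. Qed.

Lemma borel_exists (T : countType) (P : T -> X -> Prop) :
  (forall t, borel [set x | P t x]) -> borel [set x | exists t, P t x].
Proof.
move=> H; have -> : [set x | exists t, P t x] =
    \bigcup_n [set x | if dec n is Some t then P t x else False].
  apply/seteqP; split=> [x [t Pt]|x [n _] /=]; first by exists (enc t) => //=; rewrite encK.
  by case: (dec n) => // t Pt; exists t.
apply: borel_bigcup => n; case: (dec n) => [t|]; first exact: H.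
by rewrite (_ : [set _ | _] = set0) //; apply: borel_open; exact: open0.
Qed.

Lemma borel_forall (T : countType) (P : T -> X -> Prop) :
  (forall t, borel [set x | P t x]) -> borel [set x | forall t, P t x].
Proof.
move=> H; have -> : [set x | forall t, P t x] = [set x | ~ exists t, ~ P t x].
  by apply/seteqP; split=> x /=; [move=> Px [t]; apply|move=> /forallNP Px t; exact: contrapT].
by apply: borel_not; apply: borel_exists => t; apply: borel_not; exact: H.
Qed.

Lemma borel_cst (P : Prop) : borel [set x : X | P].
Proof.
have [p|np] := pselect P.
  by rewrite (_ : [set _ | _] = setT); [apply: borel_open; exact: openT|apply/seteqP; split].
by rewrite (_ : [set _ | _] = set0); [apply: borel_open; exact: open0|apply/seteqP; split].
Qed.

Lemma borel_and (P Q : X -> Prop) :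
  borel [set x | P x] -> borel [set x | Q x] -> borel [set x | P x /\ Q x].
Proof.
move=> bP bQ; have -> : [set x | P x /\ Q x] = [set x | forall b : bool, if b then P x else Q x].
  apply/seteqP; split=> x /= H; first by case: H => p q [].
  by split; [exact: (H true)|exact: (H false)].
by apply: borel_forall => -[].
Qed.

Lemma borel_impl (P : Prop) (Q : X -> Prop) :
  (P -> borel [set x | Q x]) -> borel [set x | P -> Q x].
Proof.
move=> bQ; have [p|np] := pselect P.
  by rewrite (_ : [set x | P -> Q x] = [set x | Q x]); [exact: bQ|apply/seteqP; split=> x /=; auto].
rewrite (_ : [set x | P -> Q x] = [set x | True]); first exact: borel_cst.
by apply/seteqP; split=> x //= _ /np.
Qed.

Definition bmeas (T : countType) (g : X -> T) : Prop := forall t, borel [set x | g x = t].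

Lemma bmeas_cst (T : countType) (c : T) : bmeas (fun=> c).
Proof. by move=> t; exact: borel_cst. Qed.

(** The values of [g] are countably many, so a fibre is a countable union over them. *)
Lemma bmeas_bind (T U : countType) (g : X -> T) (h : T -> X -> U) :
  bmeas g -> (forall t, bmeas (h t)) -> bmeas (fun x => h (g x) x).
Proof.
move=> bg bh u; have -> : [set x | h (g x) x = u] = [set x | exists t, g x = t /\ h t x = u].
  by apply/seteqP; split=> x /=; [exists (g x)|move=> [t [-> ]]].
by apply: borel_exists => t; apply: borel_and; [exact: bg|exact: bh].
Qed.

Lemma bmeas_map (T U : countType) (g : X -> T) (h : T -> U) :
  bmeas g -> bmeas (fun x => h (g x)).
Proof. by move=> bg; apply: (bmeas_bind (h := fun t _ => h t)) => // t; exact: bmeas_cst. Qed.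

Lemma bmeas_map2 (T U V : countType) (g : X -> T) (g' : X -> U) (h : T -> U -> V) :
  bmeas g -> bmeas g' -> bmeas (fun x => h (g x) (g' x)).
Proof.
move=> bg bg'; apply: (bmeas_bind (h := fun t x => h t (g' x))) => // t.
exact: bmeas_map.
Qed.

Lemma bmeas_asbool (P : X -> Prop) : borel [set x | P x] -> bmeas (fun x => `[< P x >]).
Proof.
move=> bP [].
  by rewrite (_ : [set _ | _] = [set x | P x]) //; apply/seteqP; split=> x /asboolP.
rewrite (_ : [set _ | _] = [set x | ~ P x]); first exact: borel_not.
by apply/seteqP; split=> x; [move=> /asboolPn|move=> nP; apply/asboolPn].
Qed.

Lemma borel_bmeas (b : X -> bool) : bmeas b -> borel [set x | b x].
Proof. exact. Qed.

Lemma bmeas_seq (A : Type) (T : countType) (f : A -> X -> T) (s : seq A) :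
  (forall a, bmeas (f a)) -> bmeas (fun x => [seq f a x | a <- s]).
Proof.
move=> bf; elim: s => [|a s IH] /=; first exact: bmeas_cst.
by apply: (bmeas_map2 cons).
Qed.

Lemma bmeas_all (A : Type) (f : A -> X -> bool) (s : seq A) :
  (forall a, bmeas (f a)) -> bmeas (fun x => all (f^~ x) s).
Proof.
move=> bf; elim: s => [|a s IH] /=; first exact: bmeas_cst.
by apply: (bmeas_map2 andb).
Qed.

Lemma bmeas_has (A : Type) (f : A -> X -> bool) (s : seq A) :
  (forall a, bmeas (f a)) -> bmeas (fun x => has (f^~ x) s).
Proof.
move=> bf; elim: s => [|a s IH] /=; first exact: bmeas_cst.
by apply: (bmeas_map2 orb).
Qed.

Lemma bmeas_pairwise (A : Type) (f : A -> A -> X -> bool) (s : seq A) :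
  (forall a b, bmeas (f a b)) -> bmeas (fun x => pairwise (fun a b => f a b x) s).
Proof.
move=> bf; elim: s => [|a s IH] /=; first exact: bmeas_cst.
apply: (bmeas_map2 andb) => //.
exact: (bmeas_all (f := fun b x => f a b x)).
Qed.

Lemma bmeas_least (T : countType) (t0 : T) (Q : X -> T -> bool) :
  (forall t, bmeas (Q^~ t)) -> bmeas (fun x => least t0 (Q x)).
Proof.
move=> bQ.
have bd n : bmeas (fun x => decoded (Q x) n).
  by rewrite /decoded; case: (dec n) => [t|]; [exact: bQ|exact: bmeas_cst].
move=> t.
have -> : [set x | least t0 (Q x) = t] = [set x | exists n, decoded (Q x) n /\
    (forall m, m < n -> ~ decoded (Q x) m) /\ odflt t0 (dec n) = t] `|`
    [set x | (forall n, ~ decoded (Q x) n) /\ t0 = t].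
  apply/seteqP; split=> x /=; rewrite /least; case: pselect => [h|h].
  - case: ex_minnP => n dn min <-; left; exists n; split=> //; split=> // m lt /min.
    by rewrite leqNgt lt.
  - by move=> <-; right; split=> // n dn; apply: h; exists n.
  - case=> [[n [dn [min e]]]|[no _]]; last by exfalso; case: h => n /no.
    case: ex_minnP => n' dn' min'; rewrite (_ : n' = n) //.
    apply/eqP; rewrite eqn_leq min' //= leqNgt; apply/negP => /min.
    exact.
  - by case=> [[n [dn _]]|[_ ->]] //; case: h; exists n.
rewrite -[_ `|` _]setCK setCU; apply: borel_setC.
apply: borel_and; apply: borel_not.
  apply: borel_exists => n; apply: borel_and; first exact: borel_bmeas.
  apply: borel_and; last exact: borel_cst.
  by apply: borel_forall => m; apply: borel_impl => _; apply: borel_not; exact: borel_bmeas.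
apply: borel_and; last exact: borel_cst.
by apply: borel_forall => n; apply: borel_not; exact: borel_bmeas.
Qed.

(** * Borel dependence of the run on the tower *)

Definition tmeas (v : X -> tower) : Prop :=
  forall q, bmeas (fun x => (v x q).1) /\ forall n, bmeas (fun x => (v x q).2 n).

Lemma tmeas_cst (t : tower) : tmeas (fun=> t).
Proof. by move=> q; split=> [|n]; exact: bmeas_cst. Qed.

(** For fixed [k] the relation unfolds into finitely many quantifiers over natural numbers. *)
Lemma borel_tree_eq k (v w : X -> tower) :
  tmeas v -> tmeas w -> borel [set x | tree_eq k (v x) (w x)].
Proof.
elim: k v w => [|k IH] v w mv mw /=.
  have -> : [set x | v x [::] = w x [::]] = [set x | (v x [::]).1 == (w x [::]).1 /\
      forall n, (v x [::]).2 n == (w x [::]).2 n].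
    apply/seteqP; split=> x /= [].
      by move=> ->; split=> // n; rewrite eqxx.
    case: (v x _) (w x _) => [a b] [c d] /= /eqP -> H.
    by congr pair; apply: funext => n; exact/eqP/H.
  apply: borel_and; first by apply: borel_bmeas; apply: bmeas_map2; [case: (mv [::])|case: (mw [::])].
  apply: borel_forall => n; apply: borel_bmeas.
  by apply: bmeas_map2; [case: (mv [::])|case: (mw [::])].
have mc u i : tmeas u -> tmeas (fun x => child (u x) i) by move=> mu q; exact: mu.
by apply: borel_and; apply: borel_forall => i; apply: borel_exists => j; apply: IH; exact: mc.
Qed.

Variables (S : X -> tower).
Hypothesis mS : tmeas S.

Lemma tmeas_el k a : tmeas (fun x => el (S x) k a).
Proof.
case: a => r b; rewrite /el /=; elim: r k => [|r IH] k /=.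
  case: b => [p|]; last exact: tmeas_cst.
  by move=> q; exact: mS.
case: k => [|k]; first exact: tmeas_cst.
move=> [|[|i] q]; [exact: (tmeas_cst delta [::])|exact: IH|exact: (tmeas_cst delta q)].
Qed.

Lemma borel_el_mem k a b : borel [set x | el_mem (S x) k a b].
Proof.
apply: borel_exists => i; apply: borel_tree_eq; first exact: tmeas_el.
by move=> q; exact: (tmeas_el k.+1 b (i :: q)).
Qed.

Lemma bmeas_related k m n : bmeas (fun x => related (S x) k m n).
Proof.
apply: (bmeas_map (fun M => decide M m.2 n.2)).
by apply: bmeas_seq => a; apply: bmeas_seq => b; apply: bmeas_asbool; exact: borel_el_mem.
Qed.

Lemma borel_name_eq k m n : borel [set x | name_eq (S x) (S x) k m n].
Proof.
rewrite (_ : [set _ | _] = [set x | m.2 = n.2 /\ (size m.1 = size n.1 /\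
      forall s, s < size m.1 -> tree_eq k (el (S x) k (nth (0, None) m.1 s))
                                         (el (S x) k (nth (0, None) n.1 s)))]); last first.
  by apply/seteqP; split=> x /=; [case|move=> [? []]; split].
apply: borel_and; first exact: borel_cst.
apply: borel_and; first exact: borel_cst.
by apply: borel_forall => s; apply: borel_impl => _; apply: borel_tree_eq; exact: tmeas_el.
Qed.

Variables (phi : nat * (nat -> bool) -> nat -> bool) (g : nat -> nat -> seq bool -> bool).
Hypothesis phiE : forall c z q, phi (c, z) q = g c q (mkseq z q.+1).

(** By [phiE] the bit uses only the number of the code and finitely many bits of its real. *)
Lemma bmeas_real_bit n q : bmeas (fun x => phi (name_code (S x) n) q).
Proof.
have -> : (fun x => phi (name_code (S x) n) q) = (fun x => g (name_code (S x) n).1 q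
    [seq (name_code (S x) n).2 i | i <- iota 0 q.+1]).
  by apply: funext => x; rewrite [name_code _ _]surjective_pairing phiE.
apply: (bmeas_map2 (fun c s => g c q s)).
  apply: (bmeas_map (fun t => enc (n.2, t))); apply: bmeas_seq => a.
  by case: (tmeas_el 0 a [::]).
apply: bmeas_seq => p /=; case: (dec p) => [[s r]|]; last exact: bmeas_cst.
apply: (bmeas_map (fun b => b && (s < size n.1))).
by case: (tmeas_el 0 (nth (0, None) n.1 s) [::]).
Qed.

Lemma bmeas_pos_val L p : bmeas (fun x => pos_val phi (S x) L p).
Proof.
rewrite /pos_val; case: (pdecode p) => [[[j q]|[[k i] j]]|]; last exact: bmeas_cst.
  case: (j < size (lev L 0)); last exact: bmeas_cst.
  by apply: (bmeas_map Some); exact: bmeas_real_bit.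
case: ((j < size (lev L k)) && (i < size (lev L k.+1))); last exact: bmeas_cst.
by apply: (bmeas_map Some); exact: bmeas_related.
Qed.

Lemma bmeas_valid st : bmeas (fun x => valid phi (S x) st).
Proof.
apply: (bmeas_map2 andb).
  apply: (bmeas_all (f := fun p x => (pdecode p == None) ||
    (pos_val phi (S x) st.2 p == Some (nth false st.1 p)))) => p.
  apply: (bmeas_map (fun v => (pdecode p == None) || (v == Some (nth false st.1 p)))).
  exact: bmeas_pos_val.
apply: (bmeas_pairwise (f := fun a b x =>
  ~~ ((a.1 == b.1) && `[< name_eq (S x) (S x) a.1 a.2 b.2 >]))) => a b.
apply: (bmeas_map (fun v => ~~ ((a.1 == b.1) && v))).
by apply: bmeas_asbool; exact: borel_name_eq.
Qed.

Lemma bmeas_next_state D n st st' : bmeas (fun x => next_state phi D (S x) n st st').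
Proof.
rewrite /next_state.
apply: (bmeas_map (andb (prefix st.1 st'.1))).
apply: (bmeas_map (andb (prefix st.2 st'.2))).
apply: (bmeas_map2 andb); first exact: bmeas_valid.
apply: (bmeas_map (andb _)).
rewrite /listed; case: (dec n) => [[k nu]|]; last exact: bmeas_cst.
apply: (bmeas_has (f := fun a x => (a.1 == k) && `[< name_eq (S x) (S x) k a.2 nu >])) => a.
apply: (bmeas_map (andb _)).
by apply: bmeas_asbool; exact: borel_name_eq.
Qed.

Lemma bmeas_run D s0 n : bmeas (fun x => run phi D s0 (S x) n).
Proof.
elim: n => [|n IH] /=; apply: bmeas_least.
  move=> st; apply: (bmeas_map (andb _)); exact: bmeas_valid.
move=> st'; apply: (bmeas_bind (h := fun st x => next_state phi D (S x) n st st')) => // st.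
exact: bmeas_next_state.
Qed.

Lemma bmeas_generic_code D s0 p : bmeas (fun x => generic_code phi D s0 (S x) p).
Proof. by apply: (bmeas_map (fun st : state => nth false st.1 p)); exact: bmeas_run. Qed.

End BorelSets.

Local Open Scope ring_scope.
Local Notation R := Rdefinitions.R.

(** * Embedding the Cantor space into the reals *)

Section Embedding.
Variable R : realType.

(** Digits [0] and [1] in base 4 leave gaps: the tail from place [n] on is at most [2 / 4 ^+ n], so
    a first difference at [n] separates the sums by at least half of [(4 ^+ n)^-1]. *)
Definition partial (u : nat -> bool) (n : nat) : R := \sum_(i < n) (u i)%:R / 4 ^+ i.

Definition embed (u : nat -> bool) : R := sup (range (partial u)).

Lemma partialS u n : partial u n.+1 = partial u n + (u n)%:R / 4 ^+ n.
Proof. by rewrite /partial big_ord_recr. Qed.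

Lemma inv4_gt0 n : 0 < (4 ^+ n)^-1 :> R.
Proof. by rewrite invr_gt0 exprn_gt0. Qed.

Lemma inv4S n : (4 ^+ n.+1)^-1 = (4 ^+ n)^-1 / 4 :> R.
Proof. by rewrite exprS invfM mulrC. Qed.

Lemma bit_bounds (b : bool) : 0 <= (b%:R : R) <= 1.
Proof. by case: b; rewrite ?lexx ?ler01. Qed.

Lemma partial_mono u m n : (m <= n)%N -> partial u m <= partial u n.
Proof.
move=> /subnK <-; elim: (n - m)%N => [|d IH]; first exact: lexx.
by rewrite addSn partialS (le_trans IH) // lerDl mulr_ge0.
Qed.

Lemma partial_upper u m n : (m <= n)%N ->
  partial u n + 2 / 4 ^+ n <= partial u m + 2 / 4 ^+ m.
Proof.
move=> /subnK <-; elim: (n - m)%N => [|d IH]; first exact: lexx.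
rewrite addSn; apply: le_trans IH; rewrite partialS inv4S.
have := inv4_gt0 (d + m); set e := (4 ^+ _)^-1 => e0.
by have /andP[] := bit_bounds (u (d + m)%N); nra.
Qed.

Lemma partial_le u m n : partial u m <= partial u n + 2 / 4 ^+ n.
Proof.
have [le|le] := leqP m n.
  apply: le_trans (partial_mono u le) _; rewrite lerDl.
  by have := inv4_gt0 n; lra.
apply: le_trans (partial_upper u (ltnW le)); rewrite lerDl.
by have := inv4_gt0 m; lra.
Qed.

Lemma embed_ge u n : partial u n <= embed u.
Proof.
apply: ub_le_sup; last by exists n.
by exists (partial u 0 + 2 / 4 ^+ 0) => _ [m _ <-]; exact: partial_le.
Qed.

Lemma embed_le u n : embed u <= partial u n + 2 / 4 ^+ n.
Proof.
apply: ge_sup; first by exists (partial u 0), 0%N.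
by move=> _ [m _ <-]; exact: partial_le.
Qed.

Lemma embed_ge0 u : 0 <= embed u.
Proof. by rewrite -[0](_ : partial u 0 = 0) ?embed_ge // /partial big_ord0. Qed.

Lemma partial_agree u v n : (forall i, (i < n)%N -> u i = v i) -> partial u n = partial v n.
Proof. by move=> H; apply: eq_bigr => i _; rewrite H. Qed.

Lemma embed_agree u v n : (forall i, (i < n)%N -> u i = v i) ->
  `|embed u - embed v| <= 2 / 4 ^+ n.
Proof.
move=> /partial_agree e.
have := embed_ge u n; have := embed_le u n; have := embed_ge v n; have := embed_le v n.
by rewrite e ler_norml; lra.
Qed.

Lemma embed_first_diff u v n : (forall i, (i < n)%N -> u i = v i) -> u n <> v n ->
  (4 ^+ n)^-1 / 2 <= `|embed u - embed v|.
Proof.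
wlog un : u v / u n.
  move=> W H ne; case un : (u n); first exact: W.
  rewrite distrC; apply: W => [|i lt|].
  - by case: (v n) ne; rewrite un.
  - by rewrite H.
  - by move=> e; apply: ne.
move=> /partial_agree e ne; have vn : v n = false by case: (v n) ne; rewrite un.
have := embed_ge u n.+1; have := embed_le v n.+1.
rewrite !partialS inv4S un vn e /= mul0r mul1r addr0.
have := inv4_gt0 n; set d := (4 ^+ n)^-1; move=> d0 h1 h2.
by rewrite ler_normr; apply/orP; left; lra.
Qed.

Lemma embed_close u v n : `|embed u - embed v| < (4 ^+ n)^-1 / 2 ->
  forall i, (i <= n)%N -> u i = v i.
Proof.
move=> H i; have [m] := ubnP i; elim: m i => // m IH i im le.
apply: contrapT => ne.
have : (4 ^+ i)^-1 / 2 <= `|embed u - embed v|.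
  apply: embed_first_diff => // j ji; apply: IH; first exact: leq_trans ji im.
  exact: leq_trans (ltnW ji) le.
move=> h; have := le_lt_trans h H.
rewrite ltr_pM2r ?invr_gt0 // ltf_pV2 ?posrE ?exprn_gt0 //.
by rewrite ltr_eXn2l ?ltr1n // ltnNge le.
Qed.

Lemma embed_inj : injective embed.
Proof.
move=> u v e; apply: funext => n; apply: (@embed_close u v n) => //.
by rewrite e subrr normr0 divr_gt0 ?inv4_gt0.
Qed.

Lemma inv4_small (e : R) : 0 < e -> exists n, 2 / 4 ^+ n < e.
Proof.
move=> e0; exists (Num.bound (2 / e)).
have : 2 / e < 4 ^+ (Num.bound (2 / e)).
  apply: lt_trans (archi_boundP _) _; first by rewrite divr_ge0 ?ltW.
  by rewrite -natrX ltr_nat ltn_expl.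
by rewrite ltr_pdivrMr // mulrC => h; rewrite ltr_pdivrMr ?exprn_gt0.
Qed.

End Embedding.

(** * Category and the topology of the Cantor space *)

Section BaireProperty.
Variable T : topologicalType.

Lemma meager_sub (A B : set T) : A `<=` B -> meager B -> meager A.
Proof. by move=> AB [F [nF BF]]; exists F; split=> //; exact: subset_trans AB BF. Qed.

Lemma nowhere_dense_meager (A : set T) : nowhere_dense A -> meager A.
Proof. by move=> nA; exists (fun=> A); split=> // x Ax; exists 0%N. Qed.

Lemma meager_bigcup (A : nat -> set T) : (forall n, meager (A n)) -> meager (\bigcup_n A n).
Proof.
move=> /choice[F HF]; exists (fun n => if dec n is Some (i, j) then F i j else F 0%N 0%N).
split=> [n|x [i _ Aix]].
  by case: (dec n) => [[i j]|]; apply: (HF _).1.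
by have [j _ Fx] := (HF i).2 x Aix; exists (enc (i, j)) => //; rewrite encK.
Qed.

Lemma meager_setU (A B : set T) : meager A -> meager B -> meager (A `|` B).
Proof.
move=> mA mB; apply: (@meager_sub _ (\bigcup_n (if n is 0%N then A else B))).
  by move=> x [Ax|Bx]; [exists 0%N|exists 1%N].
by apply: meager_bigcup => -[].
Qed.

Lemma meager_set0 : meager (@set0 T).
Proof.
apply: nowhere_dense_meager; rewrite /nowhere_dense.
have /closure_id <- : closed (@set0 T) by exact: closed0.
by rewrite -subset0; exact: interior_subset.
Qed.

Lemma boundary_nowhere_dense (B : set T) : closed B -> nowhere_dense (B `\` interior B).
Proof.
move=> cB; rewrite /nowhere_dense; have : closed (B `\` interior B).
  by rewrite setDE; apply: closedI => //; apply: open_closedC; exact: open_interior.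
move=> /closure_id <-; rewrite -subset0 => x xi.
have [_] := interior_subset xi; apply.
by apply: filterS xi => z [].
Qed.

Definition baire_property : set (set T) :=
  [set C | exists U, open U /\ meager ((C `\` U) `|` (U `\` C))].

Lemma borel_baire_property (C : set T) : borel C -> baire_property C.
Proof.
apply: smallest_sub => [|U oU]; last first.
  by exists U; split=> //; rewrite setDv setU0; exact: meager_set0.
split.
- exists set0; split; first exact: open0.
  by rewrite setDv setU0; exact: meager_set0.
(* The closed complement of [U] differs from its interior by a nowhere dense boundary. *)
- move=> A [U [oU mU]]; exists (interior (~` U)); split; first exact: open_interior.
  have cU : closed (~` U) by exact: open_closedC.
  apply: meager_sub (meager_setU mU (nowhere_dense_meager (boundary_nowhere_dense cU))).
  rewrite setTD => x [[nA ni]|[ix /contrapT Ax]].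
    by have [Ux|nUx] := pselect (U x); [left; right|right].
  by left; left; split=> //; exact: interior_subset ix.
move=> A /choice[U HU]; exists (\bigcup_n U n); split.
  by apply: bigcup_open => n _; case: (HU n).
apply: (@meager_sub _ (\bigcup_n ((A n `\` U n) `|` (U n `\` A n)))).
  move=> x [[[n _ An] nU]|[[n _ Un] nA]]; exists n => //.
    by left; split=> // Un; apply: nU; exists n.
  by right; split=> // An; apply: nA; exists n.
by apply: meager_bigcup => n; case: (HU n).
Qed.

End BaireProperty.

Lemma prod_continuous (I : eqType) (K : I -> topologicalType) (T : topologicalType)
    (f : T -> prod_topology K) :
  (forall i, continuous (fun x => f x i)) -> continuous f.
Proof.
move=> cf x; apply/cvg_sup => i A.
rewrite (@nbhsE (initial_topology (fun g : (forall i, K i) => g i))).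
move=> -[B [] [V oV eB] Ox sub]; rewrite -eB in Ox sub.
apply: filterS sub _.
by apply: (cf i x); apply: open_nbhs_nbhs; split.
Qed.

Definition cantor : topologicalType := prod_topology (fun _ : nat => bool).

Definition agree_below (n : nat) (y z : nat -> bool) : Prop :=
  forall i, (i < n)%N -> z i = y i.

Lemma agree_below_open n (y : cantor) : open [set z : cantor | agree_below n y z].
Proof.
elim: n => [|n IH].
  rewrite (_ : [set _ | _] = setT); first exact: openT.
  by apply/seteqP; split.
rewrite (_ : [set _ | _] = [set z : cantor | agree_below n y z] `&`
   (@proj nat (fun=> bool) n) @^-1` [set y n]).
  apply: openI => //; apply: open_comp => [z _|]; first exact: proj_continuous.
  exact: discrete_open.
apply/seteqP; split=> [z H|z [H e] i] /=.
  by split=> [i lt|]; apply: H => //; exact: ltnW.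
by rewrite ltnS leq_eqVlt => /orP[/eqP->|/H].
Qed.

Lemma cantor_openP (A : set cantor) : open A <->
  forall y, A y -> exists n, forall z, agree_below n y z -> A z.
Proof.
split=> [oA y Ay|H]; last first.
  rewrite openE => y /H[n Hn]; rewrite /interior.
  apply: (@filterS _ _ _ [set z : cantor | agree_below n y z]) => //.
  by apply: open_nbhs_nbhs; split; [exact: agree_below_open|].
(* The filter generated by the cylinders around [y] converges to [y] in each coordinate, hence in
   the product, so it contains [A]. *)
pose F := filter_from [set: nat] (fun n => [set z : cantor | agree_below n y z]).
have FF : Filter F.
  apply: filter_from_filter; first by exists 0%N.
  move=> m n _ _; exists (maxn m n) => // z Hz.
  by split=> i lt; apply: Hz; rewrite leq_max lt ?orbT.
suff /(_ A (open_nbhs_nbhs (conj oA Ay)))[n _ Hn] : F --> (y : cantor) by exists n.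
apply/cvg_sup => i B; rewrite (@nbhsE (initial_topology (fun g : nat -> bool => g i))).
move=> -[B' [] [V oV eB] Oy sub]; rewrite -eB in Oy sub.
apply: filterS sub _; exists i.+1 => // z /(_ i (ltnSn i)) e.
by rewrite /= e.
Qed.

Lemma agree_below_mkseq n (y z : nat -> bool) : extends z (mkseq y n) <-> agree_below n y z.
Proof.
split=> H i; first by move=> lt; rewrite -H ?size_mkseq // nth_mkseq.
by rewrite size_mkseq => lt; rewrite nth_mkseq ?H.
Qed.

Lemma nowhere_dense_avoid (A : set cantor) (s : seq bool) : nowhere_dense A ->
  exists s', prefix s s' /\ forall z, extends z s' -> ~ A z.
Proof.
move=> nA.
have [y [ys nAy]] : exists y : cantor, extends y s /\ ~ closure A y.
  apply: contrapT => /forallNP H.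
  suff : interior (closure A) (nth false s : cantor) by rewrite nA.
  rewrite /interior; apply: (@filterS _ _ _ [set z : cantor | agree_below (size s) (nth false s) z]).
    move=> z Hz; apply: contrapT => nz; apply: (H z); split=> // i lt.
    by rewrite Hz.
  by apply: open_nbhs_nbhs; split; [exact: agree_below_open|].
have /cantor_openP/(_ y nAy)[n Hn] : open (~` closure A).
  by apply: closed_openC; exact: closed_closure.
exists (mkseq y (maxn n (size s))); split.
  by apply: prefix_mkseq => //; rewrite leq_max leqnn orbT.
move=> z /agree_below_mkseq Hz Az; apply: (Hn z); last exact: subset_closure.
by move=> i lt; apply: Hz; rewrite leq_max lt.
Qed.

(** The Baire category theorem, obtained from the fusion lemma for one-tuples: a value of [phi]
    avoids every [F l]. *)
Lemma cantor_nonmeager : ~ meager [set: cantor].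
Proof.
move=> [F [nF cov]].
pose G l (t : seq (seq bool)) := size t = 1%N ->
  forall z, extends z (nth [::] t 0) -> ~ F l z.
have G_dense l t : exists t', [/\ size t' = size t,
    (forall i, prefix (nth [::] t i) (nth [::] t' i)) & G l t'].
  have [s1|n1] := eqVneq (size t) 1%N; last first.
    by exists t; split=> // [i|/eqP]; [exact: prefix_refl|rewrite (negbTE n1)].
  case: t s1 => [|s [|]] // _.
  have [s' [ss' Hs']] := nowhere_dense_avoid s (nF l).
  exists [:: s']; split=> // [[|i] //=|_ z]; first by rewrite nth_nil prefix_refl.
  exact: Hs'.
have [phi [_ _ phi_generic]] := mycielski (fun=> [::]) G_dense.
have [l _ Fl] := cov (phi (0%N, fun=> false)) I.
have [|t [st /(_ 0%N)]] := phi_generic l [:: (0%N, fun=> false)] (0%N, fun=> false).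
  by move=> [|i] [|j].
by rewrite st => /(_ isT) e /(_ st) /(_ _ e).
Qed.

(** By the Baire property [C] is comeager in a nonempty open [U]. The string [s0] fixes a cylinder
    inside [U], and [D n] avoids the [n]-th nowhere dense set covering the difference. *)
Lemma nonmeager_generic (C : set cantor) : borel C -> ~ meager C ->
  exists (s0 : seq bool) (D : nat -> seq bool -> Prop),
    [/\ forall n s, exists s', prefix s s' /\ D n s',
        forall n s, D n s -> (n < size s)%N &
        forall y, extends y s0 -> (forall n, exists s, extends y s /\ D n s) -> C y].
Proof.
move=> bC nmC; have [U [oU mU]] := borel_baire_property bC.
have [y Uy] : exists y, U y.
  apply: contrapT => /forallNP U0; apply: nmC; apply: meager_sub mU => x Cx.
  by left; split=> //; exact: U0.
have [n0 H0] := (cantor_openP U).1 oU y Uy.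
have [F [nF subF]] := mU.
exists (mkseq y n0), (fun n s => (n < size s)%N /\ forall z, extends z s -> ~ F n z).
split=> [n s|n s []//|z ez gz].
  have [s' [ss' Hs']] := nowhere_dense_avoid s (nF n).
  exists (s' ++ nseq n.+1 false); split; first exact: prefix_trans ss' (prefix_prefix _ _).
  split=> [|z ez]; first by rewrite size_cat size_nseq addnS ltnS leq_addl.
  by apply: Hs'; exact: extends_prefix (prefix_prefix _ _) ez.
have Uz : U z by apply: H0; exact/agree_below_mkseq.
apply: contrapT => nCz; have [|n _ Fz] := subF z; first by right.
by have [s [es [_ /(_ z es)]]] := gz n; exact.
Qed.

(** The metric is pulled back along [embed], for which small distance amounts to agreement on a long
    initial segment. *)
Lemma cantor_polish : polish cantor.
Proof.
split.
  exists (range (fun s : seq bool => (nth false s : cantor))); split.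
    by apply: sub_countable (card_image_le _ _) _; exact: countableP.
  rewrite -subTset => y _ B; rewrite nbhsE => -[A [oA Ay] sub].
  have [n Hn] := (cantor_openP A).1 oA y Ay.
  exists (nth false (mkseq y n)); split; first by exists (mkseq y n).
  by apply/sub/Hn => i lt; rewrite nth_mkseq.
exists (fun y z => `|embed R y - embed R z|); split; [|split].
- split; [by move=> *; exact: normr_ge0|split; [|split]].
  + move=> x y; split=> [/eqP|->]; last by rewrite subrr normr0.
    by rewrite normr_eq0 subr_eq0 => /eqP /embed_inj.
  + by move=> x y; rewrite distrC.
  + by move=> x y z; exact: ler_distD.
- move=> A; rewrite cantor_openP; split=> H y Ay.
    have [n Hn] := H y Ay; exists ((4 ^+ n)^-1 / 2); split; first by rewrite divr_gt0 ?inv4_gt0.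
    by move=> z /= /embed_close e; apply: Hn => i lt; rewrite -e // ltnW.
  have [e [e0 He]] := H y Ay; have [n Hn] := inv4_small e0.
  exists n => z Hz; apply: He => /=; apply: le_lt_trans Hn.
  by apply: embed_agree => i lt; rewrite Hz.
- move=> u Hu.
  have /choice[N HN] : forall n, exists N, forall m m', (N <= m)%N -> (N <= m')%N ->
      forall i, (i <= n)%N -> u m i = u m' i.
    move=> n; have [|N HN] := Hu ((4 ^+ n)^-1 / 2); first by rewrite divr_gt0 ?inv4_gt0.
    by exists N => m m' le le'; exact: embed_close (HN m m' le le').
  (* A Cauchy sequence stabilises on each bit; bit [n] of the limit is read from index [N n] on. *)
  exists (fun n => u (N n) n) => e e0; have [n Hn] := inv4_small e0.
  have [M HM] : exists M, forall m, (M <= m)%N -> forall i, (i < n)%N -> (N i <= m)%N.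
    by apply: exists_bound => i _; exists (N i).
  exists M => m le; apply: le_lt_trans Hn; apply: embed_agree => i lt.
  by apply: HN => //; exact: HM.
Qed.

(** * Borel maps and continuity on the Cantor space *)

Lemma borel_fun_open (X Y : topologicalType) (f : X -> Y) :
  (forall A, open A -> borel (f @^-1` A)) -> borel_fun f.
Proof.
move=> H; apply: smallest_sub => //; split.
- by rewrite preimage_set0; apply: borel_open; exact: open0.
- by move=> A bA; rewrite setTD preimage_setC; exact: borel_setC.
- by move=> A bA; rewrite preimage_bigcup; exact: borel_bigcup.
Qed.

Lemma borel_fun_continuous (X Y : topologicalType) (f : X -> Y) : continuous f -> borel_fun f.
Proof.
move=> /continuousP cf; apply: borel_fun_open => A oA; apply: borel_open.
exact: cf.
Qed.

Lemma borel_fun_comp (X Y Z : topologicalType) (f : X -> Y) (g : Y -> Z) :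
  borel_fun f -> borel_fun g -> borel_fun (g \o f).
Proof. by move=> bf bg B bB; exact: (bf _ (bg B bB)). Qed.

Lemma borel_fun_cantor (X : topologicalType) (f : X -> cantor) :
  (forall n, bmeas (fun x => f x n)) -> borel_fun f.
Proof.
move=> bf; apply: borel_fun_open => A /cantor_openP oA.
have -> : f @^-1` A = [set x | exists s : seq bool,
    (forall z, extends z s -> A z) /\ extends (f x) s].
  apply/seteqP; split=> [x Ax|x [s [sA fs]]]; last exact: sA.
  have [n Hn] := oA _ Ax; exists (mkseq (f x) n); split.
    by move=> z /agree_below_mkseq /Hn.
  exact/agree_below_mkseq.
apply: borel_exists => s; apply: borel_and; first exact: borel_cst.
apply: borel_forall => i; apply: borel_impl => _.
rewrite (_ : [set _ | _] = [set x | f x i = nth false s i]); first exact: bf.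
by apply/seteqP; split=> x /=.
Qed.

Lemma cantor_continuous (f : cantor -> R) :
  (forall y (e : R), 0 < e -> exists n, forall z, agree_below n y z -> `|f y - f z| < e) ->
  continuous f.
Proof.
move=> H y; apply/cvg_ballP => e e0.
have [n Hn] := H y e e0.
have : nbhs y [set z : cantor | agree_below n y z].
  by apply: open_nbhs_nbhs; split; [exact: agree_below_open|].
by apply: filterS => z /Hn.
Qed.

Lemma open_lt_real (r : R) : open [set x : R | x < r].
Proof.
rewrite openE => x /= xr; apply/nbhs_ballP; exists (r - x); first by rewrite /= subr_gt0.
move=> y; rewrite /ball /= => h; have := ler_norm (y - x); rewrite distrC => h'.
by have := le_lt_trans h' h; rewrite ltrBlDr subrK.
Qed.

(** * The reduction *)

Lemma fs_jumpP (X : Type) (E : X -> X -> Prop) (x y : nat -> X) : Defs.equivalence_rel E ->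
  fs_jump E x y <->
  (forall i, exists j, E (x i) (y j)) /\ (forall j, exists i, E (x i) (y j)).
Proof.
move=> [refl [sym trans]]; rewrite /fs_jump.
have classE a b : E a b -> [set z | E a z] = [set z | E b z].
  by move=> ab; apply/seteqP; split=> z /=; apply: trans => //; exact: sym.
split=> [e|[H1 H2]].
  split=> i.
    have : range (fun i => [set z | E (x i) z]) [set z | E (x i) z] by exists i.
    by rewrite e => -[j _ /seteqP[+ _]] => /(_ (y j) (refl _)); exists j.
  have : range (fun i => [set z | E (y i) z]) [set z | E (y i) z] by exists i.
  rewrite -e => -[j _ /seteqP[+ _]] => /(_ (x j) (refl _)) /= h.
  by exists j; exact: sym.
apply/seteqP; split=> _ [i _ <-].
  by have [j h] := H1 i; exists j => //; apply: classE; exact: sym.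
by have [j h] := H2 i; exists j => //; exact: classE.
Qed.

(** * Iterated jumps as equality of trees of reals *)

Fixpoint leaf (m : nat) : plus_space m -> seq nat -> R :=
  match m return plus_space m -> seq nat -> R with
  | 0 => fun x _ => x
  | m'.+1 => fun x q => if q is i :: q' then @leaf m' (x i) q' else @leaf m' (x 0%N) [::]
  end.

Fixpoint of_leaves (m : nat) (v : seq nat -> R) : plus_space m :=
  match m return plus_space m with
  | 0 => v [::]
  | m'.+1 => fun i => of_leaves m' (child v i)
  end.

Lemma eq_plus_equivalence_of_leaf m : (forall x y : plus_space m,
    eq_plus x y <-> tree_eq m (leaf x) (leaf y)) -> Defs.equivalence_rel (@eq_plus m).
Proof.
move=> H; split; [|split].
- by move=> x; apply/H; exact: tree_eq_refl.
- by move=> x y /H h; apply/H; exact: tree_eq_sym.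
- by move=> x y z /H h1 /H h2; apply/H; exact: tree_eq_trans h1 h2.
Qed.

Lemma eq_plus_leaf m (x y : plus_space m) : eq_plus x y <-> tree_eq m (leaf x) (leaf y).
Proof.
elim: m x y => [|m IH] x y //=.
rewrite fs_jumpP; last exact: eq_plus_equivalence_of_leaf.
by split=> -[H1 H2]; split=> i; [have [j /IH] := H1 i|have [j /IH] := H2 i|
  have [j h] := H1 i|have [j h] := H2 i]; exists j => //; exact/IH.
Qed.

Lemma eq_plus_equivalence m : Defs.equivalence_rel (@eq_plus m).
Proof. exact: eq_plus_equivalence_of_leaf (@eq_plus_leaf m). Qed.

Lemma leaf_of_leaves m v q : size q = m -> leaf (of_leaves m v) q = v q.
Proof. by elim: m v q => [|m IH] v [|i q] //= [sq]; rewrite IH. Qed.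

Lemma eq_plus_of_leaves m v w :
  eq_plus (of_leaves m v) (of_leaves m w) <-> tree_eq m v w.
Proof.
rewrite eq_plus_leaf.
have e u : tree_eq m (leaf (of_leaves m u)) u.
  by apply: tree_eq_ext => q; exact: leaf_of_leaves.
split=> h; first exact: tree_eq_trans (tree_eq_sym (e v)) (tree_eq_trans h (e w)).
exact: tree_eq_trans (e v) (tree_eq_trans h (tree_eq_sym (e w))).
Qed.

Lemma of_leaves_continuous (T : topologicalType) m (v : T -> seq nat -> R) :
  (forall q, continuous (fun t => v t q)) -> continuous (fun t => of_leaves m (v t)).
Proof.
elim: m v => [|m IH] v cv /=; first exact: cv.
apply: (@prod_continuous _ (fun=> plus_space m)) => i /=.
by apply: (IH (fun t => child (v t) i)) => q; exact: cv.
Qed.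

Lemma leaf_continuous m q : continuous (fun x : plus_space m => leaf x q : R).
Proof.
elim: m q => [|m IH] q /=; first by move=> x; exact: cvg_id.
have pc i : continuous (fun x : plus_space m.+1 => x i).
  exact: (@proj_continuous _ (fun _ : nat => plus_space m) i).
case: q => [|i q] x.
  apply: (@continuous_comp _ _ _ _ (fun y : plus_space m => leaf y [::] : R) x (pc 0%N x)).
  exact: IH.
apply: (@continuous_comp _ _ _ _ (fun y : plus_space m => leaf y q : R) x (pc i x)).
exact: IH.
Qed.


Lemma content_continuous k j q : continuous (fun y : cantor => content (embed R) y k j q : R).
Proof.
apply: cantor_continuous; elim: k j q => [|k IH] j q y e e0 /=.
  have [n Hn] := @inv4_small R e e0.
  have [b Hb] := bound_below n (fun i => pcode (inl (j, i))).
  exists b => z Hz; apply: le_lt_trans Hn; apply: embed_agree => i lt.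
  by rewrite /real_at Hz // Hb.
case: q => [|i q]; first by exists 0%N => z _; rewrite subrr normr0.
have [n Hn] := IH i q y e e0.
exists (maxn n (pcode (inr (k, j, i))).+1) => z Hz.
rewrite Hz ?leq_max ?leqnn ?orbT //.
case: ifP => _; last by rewrite subrr normr0.
by apply: Hn => i' lt; apply: Hz; rewrite leq_max lt.
Qed.

Definition decoding (n : nat) (y : cantor) : plus_space n :=
  of_leaves n (contents (embed R) y n).

Lemma decoding_continuous n : continuous (@decoding n).
Proof.
apply: of_leaves_continuous => q; rewrite /contents.
case: n => [|k]; first exact: cst_continuous.
case: q => [|i q]; first exact: cst_continuous.
exact: content_continuous.
Qed.

(** * The tower of a sequence of hereditary sets *)

Definition cut (r : R) : nat -> bool :=
  fun n => if (dec n : option rat) is Some q then r < ratr q else false.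

Lemma cut_inj : injective cut.
Proof.
have sep (r s : R) : r < s -> cut r <> cut s.
  move=> /rat_in_itvoo[q]; rewrite in_itv /= => /andP[rq qs].
  move=> /(congr1 (@^~ (enc q))); rewrite /cut encK rq => /esym.
  by rewrite ltNge (ltW qs).
move=> r s e; have [rs|sr|//] := ltgtP r s; first by have := sep _ _ rs.
by have := sep _ _ sr; rewrite e.
Qed.

(** One tower holds all coordinates: paths of length [m] carry coordinate [m], so the element of
    level [k] at path [p] lies inside coordinate [size p + k]. The tag is shifted by one, [0] being
    that of [delta]. *)
Definition tower_of (x : plus_omega_space) : tower :=
  fun p => ((size p).+1, cut (leaf (x (size p)) p)).

Lemma tmeas_tower_of : tmeas tower_of.
Proof.
move=> p; split=> [|n] /=; first exact: bmeas_cst.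
rewrite /cut; case: (dec n) => [q|]; last exact: bmeas_cst.
rewrite (_ : (fun _ => _) = fun x : plus_omega_space =>
  `[< leaf (x (size p)) p < ratr q >]); last first.
  by apply: funext => x; rewrite asboolb.
(* A bit of a cut is a strict inequality, hence an open condition on the leaf. *)
apply: bmeas_asbool; apply: borel_open.
have c : continuous (fun x : plus_omega_space => leaf (x (size p)) p : R).
  move=> x; apply: (@continuous_comp _ _ _ _ (fun y : plus_space (size p) => leaf y p : R) x
    (@proj_continuous _ (fun n : nat => plus_space n) (size p) x)).
  exact: leaf_continuous.
by move/continuousP: c => /(_ _ (@open_lt_real (ratr q))).
Qed.

Lemma tower_of_at x m (p : seq nat) : size p = m ->
  tower_of x p = (m.+1, cut (leaf (x m) p)).
Proof. by move=> <-. Qed.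

Lemma pair_cut_inj (m : nat) : injective (fun r : R => (m, cut r)).
Proof. by move=> r s [/cut_inj]. Qed.

Lemma tree_eq_tower_of x x' k m (p p' : seq nat) :
  size p = size p' -> m = (size p + k)%N ->
  tree_eq k (fun q => tower_of x (p ++ q)) (fun q => tower_of x' (p' ++ q)) <->
  tree_eq k (fun q => leaf (x m) (p ++ q)) (fun q => leaf (x' m) (p' ++ q)).
Proof.
move=> sp em; rewrite -(tree_eq_map _ _ _ (@pair_cut_inj m.+1)).
have e1 : tree_eq k (fun q => tower_of x (p ++ q))
    ((fun r => (m.+1, cut r)) \o (fun q => leaf (x m) (p ++ q))).
  by apply: tree_eq_ext => q sq; apply: tower_of_at; rewrite size_cat sq.
have e2 : tree_eq k (fun q => tower_of x' (p' ++ q))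
    ((fun r => (m.+1, cut r)) \o (fun q => leaf (x' m) (p' ++ q))).
  by apply: tree_eq_ext => q sq; apply: tower_of_at; rewrite size_cat sq -sp.
split=> h; first exact: tree_eq_trans (tree_eq_sym e1) (tree_eq_trans h e2).
exact: tree_eq_trans e1 (tree_eq_trans h (tree_eq_sym e2)).
Qed.

(** The element of level [k] at path [p] is matched inside coordinate [size p + k] by descending
    along [p]; separators follow by induction on [r]. *)
Lemma sub_level_tower_of x x' : eq_plus_omega x x' ->
  forall k, sub_level (tower_of x) (tower_of x') k.
Proof.
move=> exx'.
suff H r b k : exists b', tree_eq k (elt (tower_of x) k r b) (elt (tower_of x') k r b').
  by move=> k [r b]; have [b' h] := H r b k; exists (r, b').
elim: r k => [|r IH] k.
  case: b => [p|]; last by exists None; exact: tree_eq_refl.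
  have /eq_plus_leaf /tree_eq_descend[p' [sp' h]] := exx' (size p + k)%N.
  by exists (Some p'); apply/(@tree_eq_tower_of x x' k (size p + k)%N p p').
case: k => [|k]; first by exists None; exact: tree_eq_refl.
have [b' h] := IH k; exists b'; split=> -[|i].
- by exists 0%N.
- by exists 1%N; exact: tree_eq_ext.
- by exists 0%N.
- by exists 1%N; exact: tree_eq_ext.
Qed.

(* Genuine elements are recognised by the labels of their leaves, which record the
   coordinate they come from; markers and separators have a leaf labelled [0]. *)
Lemma genuine_element x x' k (p : seq nat) a :
  tree_eq k (el (tower_of x) k (0%N, Some p)) (el (tower_of x') k a) ->
  exists p', size p' = size p /\ a = (0%N, Some p').
Proof.
move=> h; have tag q : size q = k -> (el (tower_of x') k a q).1 = (size p + k).+1.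
  apply: (tree_eq_forall (P := fun l => l.1 = (size p + k).+1) h) => q' sq'.
  by rewrite /el /= size_cat sq'.
case: a {h} tag => -[|r] b tag.
  case: b tag => [p'|] tag; last by have := tag (nseq k 0%N) (size_nseq _ _).
  have := tag (nseq k 0%N) (size_nseq _ _); rewrite /el /= size_cat size_nseq.
  by move=> [/addIn e]; exists p'.
case: k tag => [|k] tag; first by have := tag [::] erefl.
by have := tag (1%N :: nseq k 0%N); rewrite /= size_nseq => /(_ erefl).
Qed.

(** The members of coordinate [k.+1] are the elements of level [k] at paths of length one, and the
    tags force their counterparts to be of the same kind. *)
Lemma sub_level_eq_plus x x' k :
  sub_level (tower_of x) (tower_of x') k -> sub_level (tower_of x') (tower_of x) k ->
  eq_plus (x k.+1) (x' k.+1).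
Proof.
have half (z z' : plus_omega_space) i : sub_level (tower_of z) (tower_of z') k ->
    exists j, tree_eq k (child (leaf (z k.+1)) i) (child (leaf (z' k.+1)) j).
  move=> s; have [a h] := s (0%N, Some [:: i]).
  have [p' [sp' ea]] := genuine_element h; case: p' sp' ea => [|j [|]] //= _ ea.
  exists j; rewrite ea in h.
  by apply/(@tree_eq_tower_of z z' k k.+1 [:: i] [:: j]).
move=> s1 s2; apply/eq_plus_leaf; split=> i; first exact: half.
by have [j h] := half x' x i s2; exists j; exact: tree_eq_sym.
Qed.

Lemma sub_level_eq0 x x' : sub_level (tower_of x) (tower_of x') 0 -> x 0%N = x' 0%N.
Proof.
move=> s; have [a h] := s (0%N, Some [::]).
have [p' [sp' ea]] := genuine_element h; case: p' sp' ea => //= _ ea; rewrite ea in h.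
by have /(_ erefl erefl)[/(_ h)] := @tree_eq_tower_of x x' 0 0 [::] [::].
Qed.

(** * Reductions into a given non-meager set *)

Lemma phi_injective (D : nat -> seq bool -> Prop) (phi : nat * (nat -> bool) -> nat -> bool) :
  (forall l (ws : seq (nat * (nat -> bool))) w0,
    (forall i j, (i < size ws)%N -> (j < size ws)%N -> nth w0 ws i = nth w0 ws j -> i = j) ->
    exists t, [/\ size t = size ws,
      (forall i, (i < size t)%N -> extends (phi (nth w0 ws i)) (nth [::] t i)) &
      requirement D l t]) ->
  injective phi.
Proof.
move=> H w w' e; apply: contrapT => ne.
have [|t [st Ht]] := H 0%N [:: w; w'] w.
  by move=> [|[|i]] [|[|j]] // _ _ /= e'; exfalso; apply: ne.
move=> /(_ st)[q [q0 q1]]; apply.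
have := Ht 0%N; have := Ht 1%N; rewrite st => /(_ isT q q1) /= -> /(_ isT q q0) /= ->.
by rewrite e.
Qed.

(** Equivalent inputs have the same elements at all levels, hence equal contents. Conversely
    [decoding n.+1] determines the elements of level [n], and with them coordinate [n.+1];
    coordinate [0] is recovered from [decoding 1], since [decoding 0] is constant. *)
Lemma generic_reduction (C : set cantor) : borel C -> ~ meager C ->
  exists f : plus_omega_space -> cantor, [/\ borel_fun f, forall x, C (f x),
    (forall x x' n, eq_plus_omega x x' -> eq_plus (decoding n (f x)) (decoding n (f x'))),
    (forall x x' n, eq_plus (decoding n.+1 (f x)) (decoding n.+1 (f x')) ->
       eq_plus (x n.+1) (x' n.+1)) &
    (forall x x', eq_plus (decoding 1 (f x)) (decoding 1 (f x')) -> x 0%N = x' 0%N)].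
Proof.
move=> bC nmC; have [s0 [D [D_dense D_size DC]]] := nonmeager_generic bC nmC.
have [phi [phi_prefix [g phiE] phi_generic]] := mycielski code_prefix
  (fun l t => requirement_dense l t D_dense).
have phi_inj := phi_injective phi_generic.
pose f x : cantor := generic_code phi D s0 (tower_of x).
have enc_f x : encodes phi (tower_of x) (f x) (enumerated phi D s0 (tower_of x)).
  split=> [j q|k i j|k nu].
  - exact: generic_code_real.
  - exact: generic_code_related.
  - exact: enumerated_onto.
have sub_levels x x' n : eq_plus (decoding n.+1 (f x)) (decoding n.+1 (f x')) ->
    sub_level (tower_of x) (tower_of x') n /\ sub_level (tower_of x') (tower_of x) n.
  move=> /eq_plus_of_leaves h; split.
    exact: (contents_sub_level (@embed_inj R) (@embed_ge0 R) phi_inj (enc_f x) (enc_f x') h).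
  apply: (contents_sub_level (@embed_inj R) (@embed_ge0 R) phi_inj (enc_f x') (enc_f x)).
  exact: tree_eq_sym.
exists f; split.
- apply: borel_fun_cantor => p.
  exact: (bmeas_generic_code tmeas_tower_of phiE).
- move=> x; apply: DC; first exact: generic_code_extends.
  exact: generic_code_generic.
- move=> x x' n e; apply/eq_plus_of_leaves.
  apply: (contents_eq _ _ (enc_f x) (enc_f x')); apply: sub_level_tower_of => //.
  by move=> m; have [_ [sym _]] := eq_plus_equivalence m; apply: sym; exact: e.
- by move=> x x' n /sub_levels[s1 s2]; exact: sub_level_eq_plus.
- by move=> x x' /sub_levels[s1 _]; exact: sub_level_eq0.
Qed.

(** The relation on the Cantor space is the pullback of [E] along [g]. As [g \o f] reduces [E] to
    itself, [f] reduces [E] to the pullback, and [f \o g] reduces the pullback to its restriction to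
    [C]. *)
Lemma spectrum_of_reductions (X : topologicalType) (E : X -> X -> Prop) (g : cantor -> X) :
  Defs.equivalence_rel E -> borel_fun g ->
  (forall C : set cantor, borel C -> ~ meager C -> exists f : X -> cantor,
    [/\ borel_fun f, forall x, C (f x) & forall x x', E x x' <-> E (g (f x)) (g (f x'))]) ->
  in_meager_spectrum E.
Proof.
move=> [refl [sym trans]] bg H.
exists cantor, (fun y z => E (g y) (g z)); split; first exact: cantor_polish.
split; first by split; [|split] => [y|y z|y z w]; [exact: refl|exact: sym|exact: trans].
split.
  split; first by exists g.
  have [||f [bf _ Ef]] := H setT; [exact: borel_cst|exact: cantor_nonmeager|by exists f].
move=> C bC nmC; split; first by exists id; split.
have [f [bf Cf Ef]] := H C bC nmC.
exists (f \o g); split; first exact: borel_fun_comp.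
by split=> [y|y z] /=; [exact: Cf|rewrite Ef].
Qed.

Theorem theorem1p8 :
  (forall n : nat, (1 <= n)%N -> in_meager_spectrum (@eq_plus n)) /\
  in_meager_spectrum eq_plus_omega.
Proof.
split=> [[//|n] _|].
  apply: (@spectrum_of_reductions _ _ (@decoding n.+1)).
  - exact: eq_plus_equivalence.
  - by apply: borel_fun_continuous; exact: decoding_continuous.
  move=> C bC nmC; have [f [bf Cf f1 f2 _]] := generic_reduction bC nmC.
  (* A single set is placed in coordinate [n.+1] of a fixed sequence; all other coordinates then
     agree. *)
  pose x0 : plus_omega_space := fun m => of_leaves m (fun=> 0).
  pose h (z : plus_space n.+1) : plus_omega_space := @dfwith _ plus_space x0 n.+1 z.
  exists (f \o h); split=> [|x|x x'].
  - apply: borel_fun_comp bf; apply: borel_fun_continuous.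
    exact: (@dfwith_continuous nat plus_space x0 n.+1).
  - exact: Cf.
  split=> [e|/f2]; last by rewrite /h !dfwithin.
  apply: (f1 (h x) (h x') n.+1) => m; rewrite /h.
  have [<-|ne] := eqVneq n.+1 m; first by rewrite !dfwithin.
  by rewrite !dfwithout //; have [refl _] := eq_plus_equivalence m; exact: refl.
apply: (@spectrum_of_reductions plus_omega_space _ (fun y n => decoding n y)).
- split; [|split]; [move=> x n|move=> x y h n|move=> x y z h1 h2 n];
    have [refl [sym trans]] := eq_plus_equivalence n.
  + exact: refl.
  + by apply: sym; exact: h.
  + by apply: trans (h1 n) (h2 n).
- apply: borel_fun_continuous; apply: prod_continuous => n; exact: decoding_continuous.
move=> C bC nmC; have [f [bf Cf f1 f2 f3]] := generic_reduction bC nmC.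
exists f; split=> // x x'; split=> [e n|h n]; first exact: f1.
case: n => [|n]; last exact/f2/h.
exact/f3/(h 1%N).
Qed.
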